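(* Suppose $p_0\in\Lambda$ and let $P=\mathcal{F}p_0$ denote its Fourier transform. Under the hypotheses (H2) and (H3) stated in the context, for all $\gamma\in\Omega$ and all $n\in\mathbb{N}$, $n\ge2$, $$\mathcal{F}R_n(\gamma,p_0)=S(g_n,n,P),$$ where $S(g_n,n,P)\in\ell^1$. For all $q\in\mathbb{Z}$ the elements of $S(g_n,n,P)$ are defined by $$S_q(g_n,n,P)=\sum_{k_1\in\mathbb{Z}}\sum_{k_2\in\mathbb{Z}}\cdots\sum_{k_{n-1}\in\mathbb{Z}}g_n(q,k_1,\dots,k_{n-1})P_{q-k_1}P_{k_1-k_2}\cdots P_{k_{n-1}},$$ where $g_n$ is the complex-valued function of $n$ variables $$g_n(q,k_1,\dots,k_{n-1})=\widehat{Z_{n,1}}(q-k_1)\widehat{Z_{n,2}}(k_1-k_2)\cdots\widehat{Z_{n,n}}(k_{n-1}).$$ Moreover, the infinite sum gives $$\mathcal{F}\sum_{n=2}^{\infty}R_n(\gamma,p_0)=\sum_{n=2}^{\infty}S(g_n,n,P)\in\ell^2.$$ In consequence, solving the system $p_0=Z\,\mathcal{G}(\gamma,p_0)$ is equivalent to solving $$\widehat{J_\gamma}P=\sum_{n=2}^{\infty}S(g_n,n,P).$$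
   Context: Setting. Time-periodic solutions are considered. For a period $\tau>0$, $T=S^\tau$ is the circle of perimeter $\tau$, and the unknown is a real-valued function $p_0\in L^2(T)$ solving $$p_0=Z\,\mathcal{G}(\gamma,p_0),$$ where $\gamma\in\mathbb{R}$ is the bifurcation parameter, $Z:L^2(T)\to L^2(T)$ is a linear operator, and $$\mathcal{G}(\gamma,p_0)=Lp_0+\sum_{n=2}^{\infty}R_n(\gamma,p_0),\qquad R_n(\gamma,p_0)=(Z_{n,1}p_0)(Z_{n,2}p_0)\cdots(Z_{n,n}p_0),$$ with $L$ a linear operator depending on $\gamma$ and $Z_{n,1},\dots,Z_{n,n}$ bounded linear operators on $L^2(T)$, possibly depending on $\gamma$. Put $J_\gamma=Z^{-1}(1-ZL)$. Fourier notation: $\ell^1,\ell^2$ are the spaces of summable, resp. square-summable, complex sequences indexed by $\mathbb{Z}$; $\mathcal{F}:L^2(T)\to\ell^2$ is given by $P_q=(\mathcal{F}p_0)(\omega_q)=\frac1\tau\int_{S^\tau}p_0(t)e^{-i\omega_qt}\,dt$ with $\omega_q=2\pi q/\tau$, and $(\mathcal{F}^{-1}P)(t)=\sum_{q\in\mathbb{Z}}P_qe^{i\omega_qt}$. The Fourier basis is $\psi_q(t)=e^{i\omega_q t}$. For an operator $A$ on $L^2(T)$, $\widehat{A}=\mathcal{F}A\mathcal{F}^{-1}$; if $A$ is diagonal in the Fourier basis, $\widehat A$ is a multiplication operator and $\widehat A(q)$ denotes its eigenvalue on $\psi_q$. Let $\mathcal{B}_\varepsilon\subset L^\infty(T)$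 be the ball of radius $\varepsilon>0$ centered at zero and $\Lambda=\mathcal{B}_\varepsilon\cap C^2(T)$, with $C^2(T)$ the twice continuously differentiable functions of $t\in T$. Parameter set: $\Omega\subset\mathbb{R}$ is the closure of a non-empty, open, simply connected set $\Omega_1\subset\mathbb{R}$ of values of the parameter $\gamma$ (in the paper, for $\varepsilon\in(0,1)$, the set where the system has a unique non-trivial real-valued periodic solution in $\Lambda$, continuous in $\gamma$), and $\gamma_0\in\Omega$ is a distinguished point (the bifurcation point, where this solution tends to zero). Hypotheses. (H2) 1) $J_\gamma$ is a closed operator acting in $L^2(T)$; it is diagonalizable and its eigenvectors are the vectors of the Fourier basis of $L^2(T)$. 2) For an integer $e\in\mathbb{Z}\setminus\{0\}$, let $Q_e,Q_{-e}$ be the orthogonal projections associated to the vectors $\psi_e,\psi_{-e}$ of the Fourier basis. Then $Q_eJ_\gamma Q_e=\beta_e(\gamma)Q_e$ and $Q_{-e}J_\gamma Q_{-e}=\beta_{-e}(\gamma)Q_{-e}$, where $\beta_e(\gamma),\beta_{-e}(\gamma)$ are two complex conjugate eigenvalues of $J_\gamma$ such that $\beta_e(\gamma_0)=0$. Moreover, for all $\gamma\in\Omega$, the operator $QJ_\gamma Q$, where $Q=1-(Q_e+Q_{-e})$, possesses a bounded inverse. (H3) For all $\gamma\in\Omega$, $n\ge2$ and $m\in\{1,\dots,n\}$, $Z_{n,m}=Z_{n,m}(\gamma):L^2(T)\to L^2(T)$ is a bounded linear operator whose eigenbasis is the Fourier basis. Moreover, for all $\gamma\in\Omega$ and $p_0\in\Lambda$,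 the series of nonlinear terms converges: $\lim_{M\to\infty}\sum_{n=2}^{M}R_n(\gamma,p_0)=\overline{R}(\gamma,p_0)\in L^2(T)$. *)

(* Defs.v *)
From HB Require Import structures.
From mathcomp Require Import all_boot all_order all_algebra.
From mathcomp Require Import complex.
From mathcomp Require Import all_classical all_reals all_analysis.

Set Implicit Arguments.
Unset Strict Implicit.
Unset Printing Implicit Defensive.

Import Order.TTheory GRing.Theory Num.Theory.
Import numFieldNormedType.Exports.

Local Open Scope classical_set_scope.
Local Open Scope ring_scope.
Local Open Scope complex_scope.

(* The circle T = S^tau is represented by [0, tau[ with Lebesgue measure:
   elements of L^2(T) are functions R -> R[i], considered only up to equality
   almost everywhere on [0, tau[; their values elsewhere are irrelevant. *)
Section Circle.
Variables (R : realType) (tau : R).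

Definition circle_measure : {measure set (measurableTypeR R) -> \bar R} :=
  mrestr (@lebesgue_measure R) (measurable_itv `[0, tau[).

Definition L2 (f : R -> R[i]) : Prop :=
  ((fun t => complex.Re (f t)) \in Lfun circle_measure 2%:E) /\
  ((fun t => complex.Im (f t)) \in Lfun circle_measure 2%:E).

Definition ae_equal (f g : R -> R[i]) : Prop :=
  ae_eq circle_measure setT f g.

Definition L2norm (f : R -> R[i]) : \bar R :=
  ('N[circle_measure]_(2%:E)[(fun t => (Normc.normc (f t))%:E)])%E.

Definition L2_converges (f_ : nat -> R -> R[i]) (f : R -> R[i]) : Prop :=
  L2norm (fun t => f_ M t - f t) @[M --> \oo] --> 0%E.

Definition cintegral (f : R -> R[i]) : R[i] :=
  (\int[circle_measure]_t complex.Re (f t)) +i* (\int[circle_measure]_t complex.Im (f t)).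

Definition expi (x : R) : R[i] := cos x +i* sin x.

Definition omega (q : int) : R := 2 * pi * q%:~R / tau.

Definition psi (q : int) (t : R) : R[i] := expi (omega q * t).

Definition fourier (f : R -> R[i]) (q : int) : R[i] :=
  (tau^-1)%:C * cintegral (fun t => f t * expi (- (omega q * t))).

(* [fourier f q] is <f, psi_q> / <psi_q, psi_q>, so this is the orthogonal
   projection onto the line spanned by psi_q. *)
Definition fourier_proj (q : int) (f : R -> R[i]) : R -> R[i] :=
  fun t => fourier f q * psi q t.

Definition to_complex (p : R -> R) : R -> R[i] := fun t => (p t)%:C.

Definition C2_circle (p : R -> R) : Prop :=
  [/\ (forall t, p (t + tau) = p t),
      (forall t, derivable p t 1),
      (forall t, derivable (derive1 p) t 1)
    & continuous (derive1 (derive1 p))].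

Definition Lambda (eps : R) (p : R -> R) : Prop :=
  C2_circle p /\ ('N[circle_measure]_(+oo)[EFin \o p] < eps%:E)%E.

(* Everywhere defined linear operators on L^2(T), acting on representatives. *)
Definition linear_map (A : (R -> R[i]) -> R -> R[i]) : Prop :=
  [/\ (forall f, L2 f -> L2 (A f)),
      (forall f g, L2 f -> L2 g -> ae_equal f g -> ae_equal (A f) (A g))
    & (forall (a : R[i]) f g, L2 f -> L2 g ->
        ae_equal (A (fun t => a * f t + g t)) (fun t => a * A f t + A g t))].

Definition bounded_linear_map (A : (R -> R[i]) -> R -> R[i]) : Prop :=
  linear_map A /\
  exists c : R, forall f, L2 f -> (L2norm (A f) <= c%:E * L2norm f)%E.

(* Operators that may be defined only on a subspace of L^2(T) are given by
   their graphs, closed under almost everywhere equality. *)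
Definition operator := (R -> R[i]) -> (R -> R[i]) -> Prop.

Definition linear_operator (A : operator) : Prop :=
  [/\ (forall f g, A f g -> L2 f /\ L2 g),
      (forall f g f' g', A f g -> L2 f' -> L2 g' ->
         ae_equal f f' -> ae_equal g g' -> A f' g'),
      (forall f g g', A f g -> A f g' -> ae_equal g g'),
      A (fun=> 0) (fun=> 0)
    & (forall (a : R[i]) f g f' g', A f g -> A f' g' ->
         A (fun t => a * f t + f' t) (fun t => a * g t + g' t))].

Definition closed_operator (A : operator) : Prop :=
  linear_operator A /\
  forall (f_ g_ : nat -> R -> R[i]) f g,
    (forall n, A (f_ n) (g_ n)) -> L2 f -> L2 g ->
    L2_converges f_ f -> L2_converges g_ g -> A f g.

Definition op_graph (A : (R -> R[i]) -> R -> R[i]) : operator :=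
  fun f g => [/\ L2 f, L2 g & ae_equal g (A f)].

Definition op_id : operator := op_graph (fun f => f).

Definition op_comp (A B : operator) : operator :=
  fun f h => exists2 g, B f g & A g h.

Definition op_inv (A : operator) : operator := fun f g => A g f.

Definition op_sub (A B : operator) : operator :=
  fun f h => exists g1 g2,
    [/\ A f g1, B f g2, L2 h & ae_equal h (fun t => g1 t - g2 t)].

Definition Jop (Z : (R -> R[i]) -> R -> R[i]) (L : operator) : operator :=
  op_comp (op_inv (op_graph Z)) (op_sub op_id (op_comp (op_graph Z) L)).

Definition eigenvalue_of (A : operator) (l : R[i]) : Prop :=
  exists f, [/\ L2 f, ~ ae_equal f (fun=> 0) & A f (fun t => l * f t)].

Definition psi_eigenvector (A : operator) (q : int) : Prop :=
  exists l : R[i], A (psi q) (fun t => l * psi q t).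

(* The eigenvalue of A on psi_q, i.e. the value at q of the multiplier
   F A F^-1 (meaningful only if psi_q is an eigenvector). *)
Definition symbol (A : operator) (q : int) : R[i] :=
  xget 0 [set l : R[i] | A (psi q) (fun t => l * psi q t)].

(* For unbounded A the second clause does not follow from the first one, even
   if A is closed. Together with closedness of A it makes the domain of A
   maximal: it is {f | (symbol A q * fourier f q)_q square-summable}. *)
Definition fourier_diagonalizable (A : operator) : Prop :=
  (forall q, psi_eigenvector A q) /\
  (forall f g, A f g -> forall q, fourier g q = symbol A q * fourier f q).

(* The operator F A F^-1 on sequences, as a graph. *)
Definition op_hat (A : operator) (P S : int -> R[i]) : Prop :=
  exists f g, [/\ A f g, fourier f = P & fourier g = S].

(* Q = 1 - (Q_e + Q_{-e}) *)
Definition Qcompl (e : int) (f : R -> R[i]) : R -> R[i] :=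
  fun t => f t - (fourier_proj e f t + fourier_proj (- e) f t).

(* QJQ is an operator in the subspace Q L^2(T); its bounded inverse on that
   subspace is given by a bounded operator B on L^2(T) preserving it. *)
Definition bounded_inverse_on_Q (e : int) (J : operator) : Prop :=
  let in_Q f := L2 f /\ ae_equal (Qcompl e f) f in
  let QJQ := op_comp (op_graph (Qcompl e)) (op_comp J (op_graph (Qcompl e))) in
  exists B, [/\ bounded_linear_map B,
    (forall f g, in_Q f -> QJQ f g -> ae_equal (B g) f)
  & (forall g, in_Q g -> in_Q (B g) /\ QJQ (B g) g)].

Definition hypothesis_H2 (Omega : set R) (gamma0 : R) (J : R -> operator)
    (e : int) (beta_p beta_m : R -> R[i]) : Prop :=
  [/\ (forall gamma, Omega gamma ->
         closed_operator (J gamma) /\ fourier_diagonalizable (J gamma)),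
      (forall gamma, Omega gamma ->
         let Q q := op_graph (fourier_proj q) in
         let scaledQ b q := op_graph (fun f t => b * fourier_proj q f t) in
         [/\ (forall f g, op_comp (Q e) (op_comp (J gamma) (Q e)) f g <->
                scaledQ (beta_p gamma) e f g),
             (forall f g,
                op_comp (Q (- e)) (op_comp (J gamma) (Q (- e))) f g <->
                scaledQ (beta_m gamma) (- e) f g),
             eigenvalue_of (J gamma) (beta_p gamma),
             eigenvalue_of (J gamma) (beta_m gamma)
           & beta_m gamma = (beta_p gamma)^*]),
      beta_p gamma0 = 0
    & (forall gamma, Omega gamma -> bounded_inverse_on_Q e (J gamma))].

(* [Zn gamma n m] is Z_{n,m}(gamma), with 1 <= m <= n. *)
Definition Rn (Zn : R -> nat -> nat -> (R -> R[i]) -> R -> R[i])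
    (gamma : R) (p : R -> R) (n : nat) : R -> R[i] :=
  fun t => \prod_(1 <= m < n.+1) Zn gamma n m (to_complex p) t.

(* [Rbar gamma p] is the sum of the series of the R_n(gamma, p), n >= 2. *)
Definition hypothesis_H3 (eps : R) (Omega : set R)
    (Zn : R -> nat -> nat -> (R -> R[i]) -> R -> R[i])
    (Rbar : R -> (R -> R) -> R -> R[i]) : Prop :=
  (forall gamma, Omega gamma -> forall n m,
     (2 <= n)%N -> (1 <= m <= n)%N ->
     bounded_linear_map (Zn gamma n m) /\
     forall q, psi_eigenvector (op_graph (Zn gamma n m)) q) /\
  (forall gamma p, Omega gamma -> Lambda eps p ->
     L2 (Rbar gamma p) /\
     L2_converges (fun M t => \sum_(2 <= n < M.+1) Rn Zn gamma p n t)
       (Rbar gamma p)).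

Definition solves (Z : (R -> R[i]) -> R -> R[i]) (L : R -> operator)
    (Rbar : R -> (R -> R) -> R -> R[i]) (gamma : R) (p : R -> R) : Prop :=
  exists2 l, L gamma (to_complex p) l &
    ae_equal (to_complex p) (Z (fun t => l t + Rbar gamma p t)).

End Circle.

Section Sequences.
Variable R : realType.

Definition l1 (a : int -> R[i]) : Prop :=
  summable setT (fun q => (Normc.normc (a q))%:E).

Definition l2 (a : int -> R[i]) : Prop :=
  summable setT (fun q => (Normc.normc (a q) ^+ 2)%:E).

Definition l2_converges (a_ : nat -> int -> R[i]) (a : int -> R[i]) : Prop :=
  (\esum_(q in setT) (Normc.normc (a_ M q - a q) ^+ 2)%:E) @[M --> \oo] --> 0%E.

(* Sum over the integers as a limit of symmetric partial sums; it is the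
   unordered sum as soon as [l1 a]. *)
Definition Zsum (a : int -> R[i]) : R[i] :=
  let partial (N : nat) := \sum_(j < N.*2.+1) a (j%:Z - N%:Z) in
  limn (fun N => complex.Re (partial N)) +i* limn (fun N => complex.Im (partial N)).

(* sum_{k_1} ... sum_{k_m} F [:: k_1; ...; k_m], the sum over k_1 being the
   outermost one. *)
Fixpoint iterZsum (m : nat) (F : seq int -> R[i]) : R[i] :=
  if m is m'.+1 then Zsum (fun k => iterZsum m' (fun ks => F (k :: ks)))
  else F [::].

Fixpoint iterZsummable (m : nat) (F : seq int -> R[i]) : Prop :=
  if m is m'.+1 then
    (forall k, iterZsummable m' (fun ks => F (k :: ks))) /\
    l1 (fun k => iterZsum m' (fun ks => F (k :: ks)))
  else True.

(* For ks = [:: k_0; ...; k_{n-1}] and j < n: k_j - k_{j+1} where k_n := 0. *)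
Definition kdiff (ks : seq int) (j : nat) : int := nth 0 ks j - nth 0 ks j.+1.

Definition Sterm (g : seq int -> R[i]) (n : nat) (P : int -> R[i])
    (ks : seq int) : R[i] :=
  g ks * \prod_(0 <= j < n) P (kdiff ks j).

Definition Sseq (g : seq int -> R[i]) (n : nat) (P : int -> R[i])
    (q : int) : R[i] :=
  iterZsum n.-1 (fun ks => Sterm g n P (q :: ks)).

Definition Sseq_defined (g : seq int -> R[i]) (n : nat) (P : int -> R[i]) :=
  forall q, iterZsummable n.-1 (fun ks => Sterm g n P (q :: ks)).

Definition gn (tau : R) (Zn : R -> nat -> nat -> (R -> R[i]) -> R -> R[i])
    (gamma : R) (n : nat) (ks : seq int) : R[i] :=
  \prod_(0 <= j < n)
     symbol tau (op_graph tau (Zn gamma n j.+1)) (kdiff ks j).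

(* Loops are based at f 0, and homotopies keep the base point fixed. *)
Definition simply_connected (A : set R) : Prop :=
  (forall x y, A x -> A y -> exists f : R -> R,
     [/\ {within `[0, 1], continuous f}, f 0 = x, f 1 = y
       & f @` `[0, 1] `<=` A]) /\
  (forall f : R -> R, {within `[0, 1], continuous f} -> f 0 = f 1 ->
     f @` `[0, 1] `<=` A ->
     exists H : R * R -> R,
       [/\ {within `[0, 1] `*` `[0, 1], continuous H},
           H @` (`[0, 1] `*` `[0, 1]) `<=` A,
           (forall s, 0 <= s <= 1 -> H (s, 0) = f s),
           (forall s, 0 <= s <= 1 -> H (s, 1) = f 0)
         & (forall u, 0 <= u <= 1 -> H (0, u) = f 0 /\ H (1, u) = f 0)]).

End Sequences.

(* Main.v *)
Require Import Defs.
From HB Require Import structures.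
From mathcomp Require Import all_boot all_order all_algebra.
From mathcomp Require Import finmap complex ring lra zify.
From mathcomp Require Import all_classical all_reals all_analysis.
From mathcomp Require Import measurable_realfun.

(** The proof takes place in the Wiener algebra of the circle, the functions of
    L^2(T) whose Fourier coefficients are summable. Such a function is almost
    everywhere the uniform limit of its Fourier series [wiener_synth].
    Uniform convergence gives two rules: the coefficients of a product are the
    convolution of the coefficients [wiener_mul], and a bounded operator that is
    diagonal in the Fourier basis multiplies the coefficients by its bounded
    symbol [wiener_multiplier]. Since p0 is of class C^2, it belongs to the
    algebra [C2_wiener]: integrating by parts, its coefficients are those of its
    derivative divided by i omega_q, a product of two square-summable sequences.
    Hence R_n, a product of n functions Z_{n,m} p0, is in the algebra as well,
    and its coefficients are an n-fold convolution. Unfolding the convolutions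
    from the outermost one gives the iterated sums S_q(g_n, n, P), all of them
    absolutely convergent [iterZsum_conv, Rn_wiener].

    The infinite sum is handled by Bessel's inequality [bessel]: convergence of
    the series of the R_n in L^2 implies convergence of the coefficients in l^2,
    to the coefficients of the sum.

    Functions are recovered from their coefficients by the uniqueness theorem
    [fourier_unique0]: a function h of L^2 without Fourier coefficients is zero.
    Multiplying h by a trigonometric polynomial does not create coefficients, so
    h is orthogonal to all trigonometric polynomials. An explicit sequence of
    them, (1 - y^n)^(2^n) with y of degree one, converges boundedly to the
    indicator function of an interval starting at 0. So the primitive of h is
    zero, and so is h by Lebesgue's differentiation theorem.

    It remains to compare p0 = Z (L p0 + sum R_n) with J P = S. The first one
    says that J p0 is the sum of the R_n [Jop_equation], which is the same as
    the equation between coefficients because functions are determined by them.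
    As J is diagonal, this implies the equation index by index. Conversely, the
    equation index by index does not say that p0 is in the domain of J; the
    bounded inverse of Q J Q produces an element of the domain with the right
    coefficients except at the indices e and -e, and the missing modes are
    eigenvectors of J [multiplier_equation]. *)

Set Implicit Arguments.
Unset Strict Implicit.
Unset Printing Implicit Defensive.

Import Order.TTheory GRing.Theory Num.Theory.
Import numFieldNormedType.Exports.

Local Open Scope classical_set_scope.
Local Open Scope ring_scope.
Local Open Scope complex_scope.

Local Notation nc := Normc.normc.
Local Notation Re := complex.Re.
Local Notation Im := complex.Im.

(** * Complex numbers *)

Section Modulus.
Variable R : realType.
Implicit Types x y z : R[i].

Lemma complex_ext x y :
  complex.Re x = complex.Re y -> complex.Im x = complex.Im y -> x = y.
Proof. by case: x => a b; case: y => c d /= -> ->. Qed.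

Lemma Re_add x y : complex.Re (x + y) = complex.Re x + complex.Re y.
Proof. by case: x; case: y. Qed.

Lemma Im_add x y : complex.Im (x + y) = complex.Im x + complex.Im y.
Proof. by case: x; case: y. Qed.

Lemma Re_opp x : complex.Re (- x) = - complex.Re x.
Proof. by case: x. Qed.

Lemma Im_opp x : complex.Im (- x) = - complex.Im x.
Proof. by case: x. Qed.

Lemma Re_mul x y : complex.Re (x * y) =
  complex.Re x * complex.Re y - complex.Im x * complex.Im y.
Proof. by case: x; case: y. Qed.

Lemma Im_mul x y : complex.Im (x * y) =
  complex.Re x * complex.Im y + complex.Im x * complex.Re y.
Proof. by case: x; case: y. Qed.

Lemma real_complexM (a b : R) : (a * b)%:C = a%:C * b%:C :> R[i].
Proof. by rewrite -rmorphM. Qed.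

Lemma real_complexB (a b : R) : (a - b)%:C = a%:C - b%:C :> R[i].
Proof. by rewrite -rmorphB. Qed.

Lemma nc_ge0 x : 0 <= nc x.
Proof. by case: x => a b; exact: sqrtr_ge0. Qed.

Lemma sqr_nc x : nc x ^+ 2 = complex.Re x ^+ 2 + complex.Im x ^+ 2.
Proof. by case: x => a b /=; rewrite sqr_sqrtr// addr_ge0 ?sqr_ge0. Qed.

Lemma nc_eq0 x : (nc x == 0) = (x == 0).
Proof.
apply/eqP/eqP => [/Normc.eq0_normc//|->]; exact: Normc.normc0.
Qed.

Lemma nc_triangle x y : nc (x + y) <= nc x + nc y.
Proof. exact: le_normcD. Qed.

Lemma nc_sub x y : nc (x - y) = nc (y - x).
Proof. by rewrite -normcN opprB. Qed.

Lemma nc_real (a : R) : nc a%:C = `|a|.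
Proof. by rewrite /= expr0n /= addr0 sqrtr_sqr. Qed.

Lemma nc_sum (I : Type) (s : seq I) (F : I -> R[i]) :
  nc (\sum_(i <- s) F i) <= \sum_(i <- s) nc (F i).
Proof.
elim: s => [|i s IH]; first by rewrite !big_nil Normc.normc0.
by rewrite !big_cons (le_trans (nc_triangle _ _))// lerD2l.
Qed.

Lemma Re_le_nc x : `|complex.Re x| <= nc x.
Proof.
rewrite -ler_sqr ?nnegrE ?nc_ge0// real_normK ?num_real// sqr_nc.
by rewrite lerDl sqr_ge0.
Qed.

Lemma Im_le_nc x : `|complex.Im x| <= nc x.
Proof.
rewrite -ler_sqr ?nnegrE ?nc_ge0// real_normK ?num_real// sqr_nc.
by rewrite lerDr sqr_ge0.
Qed.

Lemma nc_le_ReIm x : nc x <= `|complex.Re x| + `|complex.Im x|.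
Proof.
rewrite -ler_sqr ?nnegrE ?nc_ge0 ?addr_ge0// sqr_nc sqrrD.
rewrite !real_normK ?num_real// lerD2r lerDl mulrn_wge0// mulr_ge0//.
Qed.

End Modulus.

(** * Summable sequences indexed by the integers *)

Definition window (N : nat) : seq int :=
  [seq (j%:Z - N%:Z)%R | j <- iota 0 N.*2.+1].
Arguments window : simpl never.

Section Windows.
Variable R : realType.
Implicit Types (a b : int -> R[i]) (s : seq int).

Lemma mem_window N q : (q \in window N) = (`|q| <= N)%N.
Proof.
apply/mapP/idP => [[j + ->]|qN]; first by rewrite mem_iota; lia.
by exists (absz (q + N%:Z)%R); [rewrite mem_iota; lia|lia].
Qed.

Lemma window_uniq N : uniq (window N).
Proof. by rewrite map_inj_uniq ?iota_uniq// => i j; lia. Qed.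

Lemma window_cover s : exists N, {subset s <= window N}.
Proof.
elim: s => [|q s [N IH]]; first by exists 0%N.
exists (maxn `|q|%N N) => p; rewrite inE => /orP[/eqP->|/IH].
  by rewrite mem_window leq_maxl.
by rewrite !mem_window => /leq_trans; apply; rewrite leq_maxr.
Qed.

Lemma window_sumE (V : nmodType) (f : int -> V) N :
  \sum_(j < N.*2.+1) f (j%:Z - N%:Z) = \sum_(q <- window N) f q.
Proof.
rewrite big_map -(big_mkord xpredT (fun j : nat => f (j%:Z - N%:Z))).
by rewrite /index_iota subn0.
Qed.

Lemma sum_subseq_le (f : int -> R) s s' : (forall q, 0 <= f q) ->
  uniq s -> uniq s' -> {subset s <= s'} ->
  \sum_(q <- s) f q <= \sum_(q <- s') f q.
Proof.
move=> f0 us us' ss'.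
have -> : \sum_(q <- s) f q = \sum_(q <- [seq q <- s' | q \in s]) f q.
  apply: perm_big; apply: uniq_perm => //; first exact: filter_uniq.
  by move=> q; rewrite mem_filter; case: (boolP (q \in s)) => //= /ss' ->.
rewrite big_filter [leRHS](bigID (mem s))/= lerDl; exact: sumr_ge0.
Qed.

(** Turns the suprema of extended reals behind [esum] and [summable] into real
    bounds on finite sums, the form in which every estimate below is made. *)
Lemma esum_leP (f : int -> R) C : (forall q, 0 <= f q) ->
  (\esum_(q in setT) (f q)%:E <= C%:E)%E <->
  (forall s, uniq s -> \sum_(q <- s) f q <= C).
Proof.
move=> f0; split=> [fC s us|fC].
  rewrite -lee_fin (le_trans _ fC)//; apply: esum_ge.
  exists [set` s]; first by split => //; exact: finite_seq.
  by rewrite -fsbig_seq// sumEFin.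
apply: ge_ereal_sup => _ /= [X [finX _] <-].
by rewrite fsbig_finite//= sumEFin lee_fin; apply: fC; exact: fset_uniq.
Qed.

Lemma summableP (f : int -> R) : (forall q, 0 <= f q) ->
  summable setT (EFin \o f) <->
  exists C, forall s, uniq s -> \sum_(q <- s) f q <= C.
Proof.
move=> f0; rewrite /summable; under eq_esum do rewrite /= ger0_norm//.
split=> [foo|[C /(esum_leP C f0) fC]]; last exact: le_lt_trans fC (ltry _).
exists (fine (\esum_(q in setT) (f q)%:E)).
by apply/esum_leP => //; rewrite fineK// ge0_fin_numE// esum_ge0// => q _; rewrite lee_fin.
Qed.

Lemma l1P a : l1 a <->
  exists C, forall s, uniq s -> \sum_(q <- s) nc (a q) <= C.
Proof. by apply: summableP => q; exact: nc_ge0. Qed.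

Lemma l2P a : l2 a <->
  exists C, forall s, uniq s -> \sum_(q <- s) nc (a q) ^+ 2 <= C.
Proof. by apply: summableP => q; rewrite exprn_ge0// nc_ge0. Qed.

(** The remainder [r] depends on the moduli of the terms only. Applied to
    [a q * psi q t], it gives convergence of a Fourier series uniformly in [t]. *)
Lemma l1_tail a : l1 a -> exists r : nat -> R,
  [/\ r N @[N --> \oo] --> 0,
      (forall N, 0 <= r N) &
      forall N s, uniq s -> {in s, forall q, q \notin window N} ->
        \sum_(q <- s) nc (a q) <= r N].
Proof.
move=> /l1P[C aC].
pose E := [set \sum_(q <- s) nc (a q) | s in [set s : seq int | uniq s]].
have E0 : E !=set0 by exists 0, [::] => //=; rewrite big_nil.
have supE : has_sup E.
  by split=> //; exists C => _ [s us <-]; exact: aC.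
have Eub s : uniq s -> \sum_(q <- s) nc (a q) <= sup E.
  by move=> us; apply: ub_le_sup; [case: supE|exists s].
pose w N := \sum_(q <- window N) nc (a q).
exists (fun N => sup E - w N); split=> [|N|N s us sN].
- apply/cvgrPdist_le => e e0.
  have [_ [s us <-] se] := sup_adherent e0 supE.
  have [N sN] := window_cover s.
  exists N => // M /= NM; rewrite sub0r normrN ger0_norm ?subr_ge0 ?Eub ?window_uniq//.
  rewrite lerBlDr -lerBlDl (le_trans (ltW se))// /w sum_subseq_le//.
  + by move=> q; exact: nc_ge0.
  + exact: window_uniq.
  + by move=> q /sN; rewrite !mem_window => /leq_trans; exact.
- by rewrite subr_ge0 Eub// window_uniq.
- rewrite lerBrDl -big_cat; apply: Eub; rewrite cat_uniq window_uniq us andbT/=.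
  by apply/hasPn => q /sN.
Qed.

Definition symsum a N : R[i] := \sum_(q <- window N) a q.

Lemma ZsumE a : Zsum a = limn (fun N => complex.Re (symsum a N)) +i*
                         limn (fun N => complex.Im (symsum a N)).
Proof.
by rewrite /Zsum; congr (_ +i* _); congr (limn _); apply/funext => N;
  rewrite window_sumE.
Qed.

Lemma nc_cvg0_ReIm (u : nat -> R[i]) (z : R[i]) : nc (u N - z) @[N --> \oo] --> 0 ->
  (complex.Re (u N) @[N --> \oo] --> complex.Re z) /\
  (complex.Im (u N) @[N --> \oo] --> complex.Im z).
Proof.
move=> /cvgrPdist_le h; split; apply/cvgrPdist_le => e /h; apply: filterS => N;
  rewrite sub0r normrN (ger0_norm (nc_ge0 _)); apply: le_trans.
  by rewrite nc_sub (le_trans _ (Re_le_nc _))// Re_add Re_opp.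
by rewrite nc_sub (le_trans _ (Im_le_nc _))// Im_add Im_opp.
Qed.

Lemma ReIm_nc_cvg0 (u : nat -> R[i]) (z : R[i]) :
  (complex.Re (u N) @[N --> \oo] --> complex.Re z) ->
  (complex.Im (u N) @[N --> \oo] --> complex.Im z) ->
  nc (u N - z) @[N --> \oo] --> 0.
Proof.
move=> hr hi.
apply: (@squeeze_cvgr _ _ _ _ (fun=> 0)
  (fun N => `|complex.Re (u N) - complex.Re z| + `|complex.Im (u N) - complex.Im z|)).
- apply: nearW => N; rewrite nc_ge0/= (le_trans (nc_le_ReIm _))//.
  by rewrite Re_add Re_opp Im_add Im_opp.
- exact: cvg_cst.
- rewrite -[X in _ --> X]addr0; apply: cvgD.
    by apply/norm_cvg0P/subr_cvg0.
  by apply/norm_cvg0P/subr_cvg0.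
Qed.

Lemma Zsum_lim a (z : R[i]) : nc (symsum a N - z) @[N --> \oo] --> 0 -> Zsum a = z.
Proof.
move=> /nc_cvg0_ReIm[hr hi]; rewrite ZsumE (cvg_lim _ hr)// (cvg_lim _ hi)//.
by case: z {hr hi}.
Qed.

Lemma symsumB a N M : (N <= M)%N -> symsum a M - symsum a N =
  \sum_(q <- [seq q <- window M | q \notin window N]) a q.
Proof.
move=> NM; rewrite [symsum a M](bigID (fun q => q \in window N)) big_filter.
suff -> : symsum a N = \sum_(q <- window M | q \in window N) a q.
  by rewrite [X in X - _]addrC addrK.
rewrite -big_filter; apply: perm_big; apply: uniq_perm; rewrite ?filter_uniq ?window_uniq// => q.
rewrite mem_filter !mem_window andbC.
by case: (leqP `|q|%N N) => [/leq_trans ->//|]; rewrite andbF.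
Qed.

Lemma symsum_cauchy a (r : nat -> R) :
  (forall N s, uniq s -> {in s, forall q, q \notin window N} ->
        \sum_(q <- s) nc (a q) <= r N) ->
  forall N M, (N <= M)%N -> nc (symsum a M - symsum a N) <= r N.
Proof.
move=> ar N M NM; rewrite symsumB//; apply: le_trans (nc_sum _ _) _.
apply: ar; first by rewrite filter_uniq// window_uniq.
by move=> q; rewrite mem_filter => /andP[].
Qed.

Lemma cvgn_of_tail (u : nat -> R) (r : nat -> R) : r N @[N --> \oo] --> 0 ->
  (forall N M, (N <= M)%N -> `|u M - u N| <= r N) -> cvgn u.
Proof.
move=> /cvgrPdist_le r0 ur; apply/cauchy_cvgP/cauchy_ballP => e e0.
have [N _ rN] := r0 (e / 4) ltac:(by rewrite divr_gt0).
have {}rN : r N <= e / 4.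
  by have := rN N (leqnn N); rewrite sub0r normrN; apply: le_trans (ler_norm _).
exists (u @` [set n | (N <= n)%N], u @` [set n | (N <= n)%N]).
  by split; exists N => // n /= Nn; exists n.
move=> [x y] [/= [n Nn <-] [m Nm <-]]; rewrite /ball/=.
have := ur _ _ Nn; have := ur _ _ Nm => h1 h2.
have -> : u n - u m = (u n - u N) - (u m - u N) by ring.
apply: le_lt_trans (ler_normB _ _) _; lra.
Qed.

(** Passing to the limit [M -> oo] in the Cauchy estimate between [symsum a N]
    and [symsum a M]; the explicit rate is what makes limits and integrals
    exchangeable later on. *)
Lemma Zsum_tail a (r : nat -> R) : r N @[N --> \oo] --> 0 ->
  (forall N s, uniq s -> {in s, forall q, q \notin window N} ->
        \sum_(q <- s) nc (a q) <= r N) ->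
  forall N, nc (symsum a N - Zsum a) <= r N.
Proof.
move=> r0 ar N.
have ca := symsum_cauchy ar.
have hr : cvgn (fun N => complex.Re (symsum a N)).
  apply: cvgn_of_tail r0 _ => n m nm; apply: le_trans (ca _ _ nm).
  by apply: le_trans (Re_le_nc _); rewrite Re_add Re_opp.
have hi : cvgn (fun N => complex.Im (symsum a N)).
  apply: cvgn_of_tail r0 _ => n m nm; apply: le_trans (ca _ _ nm).
  by apply: le_trans (Im_le_nc _); rewrite Im_add Im_opp.
have lim0 : nc (symsum a N - Zsum a) @[N --> \oo] --> 0.
  by apply: ReIm_nc_cvg0; rewrite ZsumE.
have /cvgr_to_ge : (nc (symsum a M - Zsum a) + r N) @[M --> \oo] --> 0 + r N.
  by apply: cvgD => //; exact: cvg_cst.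
rewrite add0r; apply; exists N => // M /= NM.
have -> : symsum a N - Zsum a = (symsum a M - Zsum a) + (symsum a N - symsum a M).
  by ring.
by rewrite (le_trans (nc_triangle _ _))// lerD2l nc_sub ca.
Qed.

Lemma Zsum_cvg a : l1 a -> nc (symsum a N - Zsum a) @[N --> \oo] --> 0.
Proof.
move=> /l1_tail[r [r0 _ ar]]; apply: (squeeze_cvgr _ (cvg_cst 0) r0).
by apply: nearW => N; rewrite nc_ge0/= (Zsum_tail r0).
Qed.

Lemma symsum_le a C N : (forall s, uniq s -> \sum_(q <- s) nc (a q) <= C) ->
  nc (symsum a N) <= C.
Proof.
by move=> aC; rewrite (le_trans (nc_sum _ _))// aC// window_uniq.
Qed.

Lemma Zsum_le a C : (forall s, uniq s -> \sum_(q <- s) nc (a q) <= C) ->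
  nc (Zsum a) <= C.
Proof.
move=> aC; have /Zsum_cvg a0 : l1 a by apply/l1P; exists C.
have /cvgr_to_ge : (nc (symsum a M - Zsum a) + C) @[M --> \oo] --> 0 + C.
  by apply: cvgD => //; exact: cvg_cst.
rewrite add0r; apply; apply: nearW => M.
rewrite -{1}(subrK (symsum a M) (Zsum a)) (le_trans (nc_triangle _ _))//.
by rewrite (nc_sub (Zsum a)) lerD2l symsum_le.
Qed.

Lemma l1_le a b : l1 b -> (forall q, nc (a q) <= nc (b q)) -> l1 a.
Proof.
move=> /l1P[C bC] ab; apply/l1P; exists C => s us.
by apply: le_trans (bC s us); apply: ler_sum.
Qed.

Lemma l1Z (c : int -> R[i]) C a : (forall q, nc (c q) <= C) -> l1 a ->
  l1 (fun q => c q * a q).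
Proof.
move=> cC /l1P[D aD]; apply/l1P; exists (C * D) => s us.
apply: (@le_trans _ _ (\sum_(q <- s) C * nc (a q))).
  by apply: ler_sum => q _; rewrite Normc.normcM ler_wpM2r// nc_ge0.
rewrite -mulr_sumr ler_wpM2l ?aD//.
exact: le_trans (nc_ge0 _) (cC 0).
Qed.

Lemma l1_bounded a : l1 a -> exists C, forall q, nc (a q) <= C.
Proof.
move=> /l1P[C aC]; exists C => q.
by have := aC [:: q] erefl; rewrite big_seq1.
Qed.

Definition conv a b (q : int) : R[i] := Zsum (fun k => a (q - k) * b k).

Lemma l1_convterm a b q : l1 a -> l1 b -> l1 (fun k => a (q - k) * b k).
Proof. by move=> /l1_bounded[C aC]; apply: (l1Z (C := C)). Qed.

(** Young's inequality for two summable sequences. The finite double sums are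
    exchanged and bounded by the product of the two norms; each coefficient of
    the convolution differs from its truncation by a quantity that tends to 0,
    and only finitely many coefficients are involved. *)
Lemma l1_conv a b : l1 a -> l1 b -> l1 (conv a b).
Proof.
move=> la lb; have /l1P[A aA] := la; have /l1P[B bB] := lb.
apply/l1P; exists (A * B) => s us.
have /cvgr_to_le : (\sum_(q <- s)
     (nc (conv a b q) - nc (symsum (fun k => a (q - k) * b k) N - conv a b q)))
     @[N --> \oo] --> \sum_(q <- s) (nc (conv a b q) - 0).
  apply: cvg_big => [|q _]; first exact: add_continuous.
  apply: cvgB; first exact: cvg_cst.
  exact/Zsum_cvg/l1_convterm.
under eq_bigr do rewrite subr0; apply; apply: nearW => N.
apply: (@le_trans _ _ (\sum_(q <- s) \sum_(k <- window N) nc (a (q - k)) * nc (b k))).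
  apply: ler_sum => q _; rewrite lerBlDr.
  set w := symsum _ N; rewrite -{1}(subrK w (conv a b q)).
  rewrite (le_trans (nc_triangle _ _))// nc_sub addrC lerD2r.
  rewrite (le_trans (nc_sum _ _))//; apply: ler_sum => k _.
  by rewrite Normc.normcM.
rewrite exchange_big/=.
apply: (@le_trans _ _ (\sum_(k <- window N) A * nc (b k))).
  apply: ler_sum => k _; rewrite -mulr_suml ler_wpM2r ?nc_ge0//.
  rewrite -(big_map (fun q => q - k) xpredT (fun q => nc (a q))).
  by apply: aA; rewrite map_inj_uniq// => x y /addIr.
rewrite -mulr_sumr ler_wpM2l ?bB ?window_uniq//.
by have := aA [::] erefl; rewrite big_nil.
Qed.

End Windows.

(** * Square-integrable functions and Fourier coefficients *)

Section CircleIntegral.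
Variables (R : realType) (tau : R).
Hypothesis tau_gt0 : 0 < tau.
Implicit Types f g h : R -> R[i].

Local Notation mu := (circle_measure tau).
Local Notation fourier := (fourier tau).
Local Notation psi := (psi tau).
Local Notation L2 := (L2 tau).
Local Notation ae_equal := (ae_equal tau).

Lemma circle_measureE A : mu A = lebesgue_measure (A `&` `[0, tau[%classic).
Proof. by []. Qed.

Lemma circle_measureT : mu setT = tau%:E.
Proof.
by rewrite circle_measureE setTI lebesgue_measure_itv/= lte_fin tau_gt0 sube0.
Qed.

(** The measure of the circle ignores the complement of [0, tau[, so negligible
    sets may be enlarged by it. *)
Lemma circle_measure_ae (P : R -> Prop) :
  {ae lebesgue_measure, forall t, 0 <= t < tau -> P t} ->
  {ae mu, forall t, P t}.
Proof.
move=> [N [mN N0 PN]]; exists (N `|` ~` `[0, tau[%classic); split.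
- by apply: measurableU => //; exact: measurableC.
- rewrite circle_measureE setIUl setICl setU0.
  apply/eqP; rewrite eq_le measure_ge0 andbT -N0; apply: le_measure; rewrite ?inE//.
  exact: measurableI.
- move=> t /= nP; case: (boolP (0 <= t < tau)) => [t0|nt]; last first.
    by right => /=; rewrite in_itv/=; exact/negP.
  by left; apply: PN => /= /(_ t0).
Qed.

Lemma circle_integral (f : measurableTypeR R -> \bar R) : mu.-integrable setT f ->
  (\int[mu]_t f t = \int[lebesgue_measure]_(t in `[0%R, tau[) f t)%E.
Proof.
move=> fi; rewrite (@negligible_integral _ _ _ mu setT (~` `[0, tau[%classic))//; first last.
- by rewrite circle_measureE setICl.
- exact: measurableC.
rewrite setDE setCK setTI; apply: eq_measure_integral => A mA Asub.
by rewrite circle_measureE setIidl.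
Qed.

Lemma circle_integrable (f : measurableTypeR R -> \bar R) : mu.-integrable setT f ->
  lebesgue_measure.-integrable `[0, tau[ f.
Proof.
move=> /integrableP[mf foo]; apply/integrableP; split.
  exact: measurable_funS mf.
apply: le_lt_trans foo; rewrite (_ : (\int[lebesgue_measure]_(t in _) _ =
  \int[mu]_(t in `[0%R, tau[%classic) `|f t|)%E); last first.
  by apply: eq_measure_integral => A mA Asub; rewrite circle_measureE setIidl.
by apply: ge0_subset_integral => //; exact: measurableT_comp.
Qed.

Definition cmeas f := measurable_fun setT (fun t => Re (f t)) /\
                      measurable_fun setT (fun t => Im (f t)).

Lemma cmeas_cst c : cmeas (fun=> c).
Proof. by split; exact: measurable_cst. Qed.

Lemma cmeasD f g : cmeas f -> cmeas g -> cmeas (fun t => f t + g t).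
Proof.
move=> [f1 f2] [g1 g2]; split.
  by under eq_fun do rewrite Re_add; exact: measurable_funD.
by under eq_fun do rewrite Im_add; exact: measurable_funD.
Qed.

Lemma cmeasM f g : cmeas f -> cmeas g -> cmeas (fun t => f t * g t).
Proof.
move=> [f1 f2] [g1 g2]; split.
  by under eq_fun do rewrite Re_mul; apply: measurable_funB; exact: measurable_funM.
by under eq_fun do rewrite Im_mul; apply: measurable_funD; exact: measurable_funM.
Qed.

Lemma cmeas_nc f : cmeas f -> measurable_fun setT (fun t => nc (f t)).
Proof.
move=> [f1 f2]; have -> : (fun t => nc (f t)) =
    (fun t => Num.sqrt (Re (f t) ^+ 2 + Im (f t) ^+ 2)).
  by apply/funext => t; case: (f t).
have ms : measurable_fun setT (@Num.sqrt R).
  by apply: continuous_measurable_fun => x; exact: sqrt_continuous.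
apply: (measurableT_comp ms).
by apply: measurable_funD; exact: measurable_funX.
Qed.

Lemma expiD x y : expi (x + y) = expi x * expi y :> R[i].
Proof.
by apply: complex_ext; rewrite ?Re_mul ?Im_mul/= ?cosD ?sinD// addrC.
Qed.

Lemma expi0 : expi 0 = 1 :> R[i].
Proof. by rewrite /expi cos0 sin0. Qed.

Lemma nc_expi x : nc (expi x : R[i]) = 1.
Proof. by rewrite /expi/= cos2Dsin2 sqrtr1. Qed.

Lemma omegaD p q : omega tau (p + q) = omega tau p + omega tau q.
Proof. by rewrite /omega intrD mulrDr mulrDl. Qed.

Lemma omegaN q : omega tau (- q) = - omega tau q.
Proof. by rewrite /omega intrN mulrN mulNr. Qed.

Lemma psiD p q t : psi (p + q) t = psi p t * psi q t.
Proof. by rewrite /Defs.psi omegaD mulrDl expiD. Qed.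

Lemma psi0 t : psi 0 t = 1.
Proof. by rewrite /Defs.psi /omega mulr0 !mul0r expi0. Qed.

Lemma psiN q t : psi (- q) t = expi (- (omega tau q * t)).
Proof. by rewrite /Defs.psi omegaN mulNr. Qed.

Lemma nc_psi q t : nc (psi q t) = 1.
Proof. exact: nc_expi. Qed.

Lemma cmeas_psi q : cmeas (psi q).
Proof.
split; apply: continuous_measurable_fun => t.
  apply: (@continuous_comp _ _ _ (fun t => omega tau q * t) cos).
    exact: mulrl_continuous.
  exact: continuous_cos.
apply: (@continuous_comp _ _ _ (fun t => omega tau q * t) sin).
  exact: mulrl_continuous.
exact: continuous_sin.
Qed.

Definition cintegrable f := mu.-integrable setT (EFin \o (fun t => Re (f t))) /\
                            mu.-integrable setT (EFin \o (fun t => Im (f t))).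

Lemma cintegrable_dom f (h : R -> R) : cmeas f ->
  (forall t, nc (f t) <= h t) -> mu.-integrable setT (EFin \o h) ->
  cintegrable f.
Proof.
move=> [f1 f2] fh hi; split; apply: (le_integrable measurableT _ _ hi).
- exact/measurable_EFinP.
- move=> t _ /=; rewrite lee_fin (le_trans (Re_le_nc _))// (le_trans (fh t))//.
  exact: ler_norm.
- exact/measurable_EFinP.
- move=> t _ /=; rewrite lee_fin (le_trans (Im_le_nc _))// (le_trans (fh t))//.
  exact: ler_norm.
Qed.

Lemma Lfun2P (u : R -> R) : u \in Lfun mu 2%:E <->
  measurable_fun setT u /\ mu.-integrable setT (EFin \o (fun t => u t ^+ 2)).
Proof.
split=> [ul|[mu_ ui]].
  split; last exact: Lfun2_integrable_sqr.
  by move: ul; rewrite inE => /andP[/[!inE]].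
rewrite inE/=; apply/andP; split; rewrite inE//=.
rewrite /finite_norm unlock poweR_lty//.
move/integrableP : ui => [_]; apply: le_lt_trans.
rewrite le_eqVlt; apply/orP; left; apply/eqP; apply: eq_integral => t _ /=.
by rewrite ?poweR_EFin powR_mulrn// real_normK ?num_real// ger0_norm ?sqr_ge0.
Qed.

Lemma L2P f : L2 f <->
  cmeas f /\ mu.-integrable setT (EFin \o (fun t => nc (f t) ^+ 2)).
Proof.
split=> [[/Lfun2P[mr ir] /Lfun2P[mi ii]]|[[mr mi] ifi]].
  split=> //; have := integrableD measurableT ir ii.
  by congr (integrable _ _ _); apply/funext => t; rewrite /= -EFinD sqr_nc.
split; apply/Lfun2P; split => //; apply: (le_integrable measurableT _ _ ifi).
- by apply/measurable_EFinP; exact: measurable_funX.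
- move=> t _ /=; rewrite lee_fin !ger0_norm ?sqr_ge0// sqr_nc lerDl sqr_ge0//.
- by apply/measurable_EFinP; exact: measurable_funX.
- move=> t _ /=; rewrite lee_fin !ger0_norm ?sqr_ge0// sqr_nc lerDr sqr_ge0//.
Qed.

Lemma L2_cmeas f : L2 f -> cmeas f.
Proof. by move=> /L2P[]. Qed.

Lemma circle_integrable_cst c : mu.-integrable setT (EFin \o (fun=> c : R)).
Proof.
apply: measurable_bounded_integrable => //=.
  by rewrite circle_measureT ltry.
exact: bounded_cst.
Qed.

Lemma L2_dom f g C : L2 f -> cmeas g -> (forall t, nc (g t) <= C * nc (f t)) ->
  L2 g.
Proof.
move=> /L2P[mf fi] mg gf; apply/L2P; split => //.
apply: (le_integrable measurableT _ _ (integrableZl measurableT (C ^+ 2) fi)).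
  by apply/measurable_EFinP; apply: measurable_funX; exact: cmeas_nc.
move=> t _ /=; rewrite lee_fin -exprMn !ger0_norm ?sqr_ge0//.
rewrite lerXn2r ?nnegrE ?nc_ge0 ?gf//.
exact: le_trans (nc_ge0 _) (gf t).
Qed.

Lemma L2_bounded g C : cmeas g -> (forall t, nc (g t) <= C) -> L2 g.
Proof.
move=> mg gC; apply: (@L2_dom (fun=> 1) _ C) => //.
  apply/L2P; split; first exact: cmeas_cst.
  exact: circle_integrable_cst.
by move=> t; rewrite Normc.normc1 mulr1.
Qed.

Lemma L2_cst c : L2 (fun=> c).
Proof. exact: (@L2_bounded _ (nc c)) (cmeas_cst c) _. Qed.

Lemma L2_psi q : L2 (psi q).
Proof.
by apply: (@L2_bounded _ 1) => [|t]; [exact: cmeas_psi|rewrite nc_psi].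
Qed.

Lemma L2D f g : L2 f -> L2 g -> L2 (fun t => f t + g t).
Proof.
move=> /L2P[mf fi] /L2P[mg gi]; apply/L2P; split; first exact: cmeasD.
have := integrableZl measurableT 2 (integrableD measurableT fi gi).
apply: le_integrable => //.
  by apply/measurable_EFinP; apply: measurable_funX; apply: cmeas_nc; exact: cmeasD.
move=> t _ /=; rewrite lee_fin ger0_norm ?sqr_ge0// ger0_norm; last first.
  by apply: mulr_ge0 => //; apply: addr_ge0; exact: sqr_ge0.
have := nc_triangle (f t) (g t); have := nc_ge0 (f t); have := nc_ge0 (g t).
have := nc_ge0 (f t + g t).
move: (nc (f t + g t)) (nc (f t)) (nc (g t)) => a b c a0 c0 b0 abc.
have h1 : a ^+ 2 <= (b + c) ^+ 2 by rewrite lerXn2r ?nnegrE// addr_ge0.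
by apply: le_trans h1 _; have := sqr_ge0 (b - c); rewrite -subr_ge0 => h2; nra.
Qed.

Lemma L2_Mbounded f g C : L2 f -> cmeas g -> (forall t, nc (g t) <= C) ->
  L2 (fun t => f t * g t).
Proof.
move=> fl mg gC; apply: (@L2_dom f _ C) => //.
  by apply: cmeasM => //; exact: L2_cmeas.
by move=> t; rewrite Normc.normcM mulrC ler_wpM2r// nc_ge0.
Qed.

Lemma L2Z c f : L2 f -> L2 (fun t => c * f t).
Proof.
move=> fl; under eq_fun do rewrite mulrC.
exact: (@L2_Mbounded _ _ (nc c)) (cmeas_cst c) _.
Qed.

Lemma L2N f : L2 f -> L2 (fun t => - f t).
Proof. by move=> fl; under eq_fun do rewrite -mulN1r; exact: L2Z. Qed.

Lemma L2B f g : L2 f -> L2 g -> L2 (fun t => f t - g t).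
Proof. by move=> fl gl; apply: L2D => //; exact: L2N. Qed.

Lemma L2_Mpsi f q : L2 f -> L2 (fun t => f t * psi q t).
Proof.
move=> fl; apply: (@L2_Mbounded _ _ 1) => //; first exact: cmeas_psi.
by move=> t; rewrite nc_psi.
Qed.

Lemma L2_sum (I : Type) (s : seq I) (F : I -> R -> R[i]) :
  (forall i, L2 (F i)) -> L2 (fun t => \sum_(i <- s) F i t).
Proof.
move=> mF; elim: s => [|i s IH].
  by under eq_fun do rewrite big_nil; exact: L2_cst.
by under eq_fun do rewrite big_cons; exact: L2D.
Qed.

Lemma L2_cintegrable f : L2 f -> cintegrable f.
Proof.
move=> /L2P[mf fi].
apply: (cintegrable_dom (h := fun t => nc (f t) ^+ 2 + 1)) => //.
  by move=> t; have := nc_ge0 (f t); nra.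
exact: (integrableD measurableT fi (circle_integrable_cst 1)).
Qed.

(** The norm only sees a function up to negligible sets, but membership in L^2
    also asks for measurability, which almost everywhere equality does not
    transfer: the Borel measure is not complete. *)
Lemma ae_cmeas_L2 f g : ae_equal f g -> cmeas f -> L2 g -> L2 f.
Proof.
move=> fg mf /L2P[mg /integrableP[_ gi]]; apply/L2P; split=> //.
apply/integrableP; split.
  by apply/measurable_EFinP; apply: measurable_funX; exact: cmeas_nc.
apply: le_lt_trans gi; rewrite le_eqVlt; apply/orP; left; apply/eqP.
apply: ae_eq_integral => //.
- by apply: measurableT_comp => //; apply/measurable_EFinP; apply: measurable_funX; exact: cmeas_nc.
- by apply: measurableT_comp => //; apply/measurable_EFinP; apply: measurable_funX; exact: cmeas_nc.
- by apply: filterS fg => t /= + _ => ->.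
Qed.

Lemma cintegralD f g : cintegrable f -> cintegrable g ->
  cintegral tau (fun t => f t + g t) = cintegral tau f + cintegral tau g.
Proof.
move=> [f1 f2] [g1 g2]; apply: complex_ext; rewrite /cintegral ?Re_add ?Im_add/=.
  by under eq_Rintegral do rewrite Re_add; rewrite RintegralD.
by under eq_Rintegral do rewrite Im_add; rewrite RintegralD.
Qed.

Lemma cintegralZ c f : cintegrable f ->
  cintegral tau (fun t => c * f t) = c * cintegral tau f.
Proof.
move=> [f1 f2].
have fz a : mu.-integrable setT (EFin \o (fun t => a * Re (f t))).
  exact: (integrableZl measurableT a f1).
have gz a : mu.-integrable setT (EFin \o (fun t => a * Im (f t))).
  exact: (integrableZl measurableT a f2).
apply: complex_ext; rewrite /cintegral ?Re_mul ?Im_mul/=.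
  by under eq_Rintegral do rewrite Re_mul; rewrite RintegralB// !RintegralZl.
by under eq_Rintegral do rewrite Im_mul; rewrite RintegralD// !RintegralZl.
Qed.

Lemma cintegral_ae f g : cmeas f -> cmeas g -> ae_equal f g ->
  cintegral tau f = cintegral tau g.
Proof.
move=> [f1 f2] [g1 g2] fg; rewrite /cintegral /Rintegral.
by congr (fine _ +i* fine _); apply: ae_eq_integral => //;
  try exact/measurable_EFinP; apply: filterS fg => t /= + _ => ->.
Qed.

Lemma fourierE f q : fourier f q =
  (tau^-1)%:C * cintegral tau (fun t => f t * psi (- q) t).
Proof.
rewrite /Defs.fourier; congr (_ * _); congr cintegral.
by apply/funext => t; rewrite psiN.
Qed.

Lemma fourierD f g q : L2 f -> L2 g ->
  fourier (fun t => f t + g t) q = fourier f q + fourier g q.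
Proof.
move=> fl gl; rewrite !fourierE -mulrDr -cintegralD; last 2 first.
- exact/L2_cintegrable/L2_Mpsi.
- exact/L2_cintegrable/L2_Mpsi.
by under eq_fun do rewrite mulrDl.
Qed.

Lemma fourierZ c f q : L2 f -> fourier (fun t => c * f t) q = c * fourier f q.
Proof.
move=> fl; rewrite !fourierE mulrCA -(cintegralZ c); last by apply: L2_cintegrable; exact: L2_Mpsi.
by under eq_fun do rewrite -mulrA.
Qed.

Lemma fourierN f q : L2 f -> fourier (fun t => - f t) q = - fourier f q.
Proof.
by move=> fl; rewrite -mulN1r -fourierZ//; under eq_fun do rewrite -mulN1r.
Qed.

Lemma fourierB f g q : L2 f -> L2 g ->
  fourier (fun t => f t - g t) q = fourier f q - fourier g q.
Proof. by move=> fl gl; rewrite fourierD ?fourierN//; exact: L2N. Qed.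

Lemma fourier_sum (I : Type) (s : seq I) (F : I -> R -> R[i]) q :
  (forall i, L2 (F i)) ->
  fourier (fun t => \sum_(i <- s) F i t) q = \sum_(i <- s) fourier (F i) q.
Proof.
move=> lF; elim: s => [|i s IH].
  rewrite big_nil -[RHS](mul0r (fourier (fun=> 0) q)) -fourierZ; last exact: L2_cst.
  by congr (fourier _ q); apply/funext => t; rewrite big_nil mul0r.
rewrite big_cons -IH -fourierD//; last exact: L2_sum.
by under eq_fun do rewrite big_cons.
Qed.

Lemma fourier_ae f g : L2 f -> L2 g -> ae_equal f g -> fourier f = fourier g.
Proof.
move=> /L2_cmeas fl /L2_cmeas gl fg; apply/funext => q; rewrite !fourierE.
congr (_ * _); apply: cintegral_ae.
- by apply: cmeasM => //; exact: cmeas_psi.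
- by apply: cmeasM => //; exact: cmeas_psi.
- by apply: filterS fg => t /= + _ => ->.
Qed.

Lemma fourier_Mpsi f k q : fourier (fun t => f t * psi k t) q = fourier f (q - k).
Proof.
rewrite !fourierE; congr (_ * _); congr cintegral; apply/funext => t.
by rewrite -mulrA -psiD opprB.
Qed.

End CircleIntegral.

(** * Integration by parts and Bessel's inequality *)

Section Bessel.
Variables (R : realType) (tau : R).
Hypothesis tau_gt0 : 0 < tau.
Implicit Types f g h : R -> R[i].

Local Notation mu := (circle_measure tau).
Local Notation fourier := (fourier tau).
Local Notation psi := (psi tau).
Local Notation L2 := (L2 tau).
Local Notation omega := (omega tau).

Lemma omega_tau q : (omega q * tau) = pi *+ 2 * q%:~R.
Proof. by rewrite /Defs.omega divfK ?gt_eqF// mulr2n; ring. Qed.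

Lemma cos_2piz (q : int) : cos (pi *+ 2 * q%:~R) = 1 :> R.
Proof.
have H n : cos (pi *+ 2 * n%:R) = 1 :> R.
  elim: n => [|n IH]; first by rewrite mulr0 cos0.
  by rewrite -natr1 mulrDr mulr1 cosD2pi.
by case: q => n; rewrite ?NegzE ?intrN ?mulrN ?cosN H.
Qed.

Lemma derivable_oo_LR (F : R -> R) a b : (forall x : R, derivable F x 1) ->
  derivable_oo_LRcontinuous F a b.
Proof.
move=> dF; have cF x : {for x, continuous F}.
  by apply: differentiable_continuous; apply/derivable1_diffP.
split; first by move=> x _.
- by apply: cvg_at_right_filter; exact: cF.
- by apply: cvg_at_left_filter; exact: cF.
Qed.

Lemma is_derive_mulrl (w x : R) : is_derive x 1 (fun t => w * t) w.
Proof. by apply: is_derive_eq; rewrite /GRing.scale/= mulr1. Qed.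

Lemma is_derive_cosZ (w x : R) :
  is_derive x 1 (fun t => cos (w * t)) (- (w * sin (w * x))).
Proof.
have H := is_derive1_comp (is_derive_cos (w * x)) (is_derive_mulrl w x).
by apply: is_derive_eq H _; ring.
Qed.

Lemma is_derive_sinZ (w x : R) :
  is_derive x 1 (fun t => sin (w * t)) (w * cos (w * x)).
Proof.
have H := is_derive1_comp (is_derive_sin (w * x)) (is_derive_mulrl w x).
by apply: is_derive_eq H _; ring.
Qed.

Lemma continuous_cosZ (w : R) : continuous (fun t => cos (w * t)).
Proof.
move=> t; apply: (@continuous_comp _ _ _ (fun t => w * t) cos).
  exact: mulrl_continuous.
exact: continuous_cos.
Qed.

Lemma continuous_sinZ (w : R) : continuous (fun t => sin (w * t)).
Proof.
move=> t; apply: (@continuous_comp _ _ _ (fun t => w * t) sin).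
  exact: mulrl_continuous.
exact: continuous_sin.
Qed.

(** The boundary terms cancel because [F * u] takes the same value at both ends. *)
Lemma circle_by_parts (F k u : R -> R) (c : R) :
  (forall t : R, is_derive t (1 : R) F (c * k t)) -> continuous k -> F tau = F 0 ->
  (forall t : R, derivable u t 1) -> continuous (derive1 u) -> u tau = u 0 ->
  (\int[lebesgue_measure]_(t in `[0, tau]) (F t * derive1 u t) =
   - (c * \int[lebesgue_measure]_(t in `[0, tau]) (k t * u t))).
Proof.
move=> dF ck Fp du cu up.
have uc : continuous u.
  by move=> t; apply: differentiable_continuous; apply/derivable1_diffP.
rewrite (@Rintegration_by_parts _ F u (fun t => c * k t) (derive1 u) 0 tau)//.
- rewrite Fp up subrr sub0r -RintegralZl//.
    by congr (- _); apply: eq_Rintegral => t _; rewrite mulrA.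
  apply: continuous_compact_integrable; first exact: segment_compact.
  by apply: continuous_subspaceT => t; apply: cvgM; [exact: ck|exact: uc].
- apply: continuous_subspaceT => t; apply: cvgM; [exact: cvg_cst|exact: ck].
- by apply: derivable_oo_LR => x; have [] := dF x.
- by move=> x _; rewrite derive1E; exact: derive_val.
- exact: continuous_subspaceT.
- exact: derivable_oo_LR.
Qed.

Lemma circle_Rintegral (u : R -> R) : mu.-integrable setT (EFin \o u) ->
  \int[mu]_t u t = \int[lebesgue_measure]_(t in `[0, tau]) u t.
Proof.
move=> ui; rewrite -(@Rintegral_itv_bndo_bndc _ (BLeft 0) tau).
  by rewrite /Rintegral circle_integral.
exact: circle_integrable.
Qed.

(** Differentiation multiplies the coefficients by [i omega q]. For a constant
    function this yields the orthogonality of the basis, for a C^1 function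
    the decay of its coefficients. *)
Lemma fourier_derive1 (u : R -> R) q :
  (forall t : R, derivable u t 1) -> continuous (derive1 u) -> u tau = u 0 ->
  L2 (to_complex u) -> L2 (to_complex (derive1 u)) ->
  fourier (to_complex (derive1 u)) q = (omega q)*i * fourier (to_complex u) q.
Proof.
move=> du cu up ul dul; rewrite !fourierE mulrCA; congr (_ * _).
have [c1 s1] := L2_cintegrable tau_gt0 (L2_Mpsi (- q) ul).
have [c2 s2] := L2_cintegrable tau_gt0 (L2_Mpsi (- q) dul).
rewrite /cintegral !circle_Rintegral//.
set w := omega (- q); have wE : omega q = - w by rewrite /w omegaN opprK.
have cwt : cos (w * tau) = 1 by rewrite omega_tau cos_2piz.
have swt : sin (w * tau) = 0.
  by apply/eqP; rewrite -sqrf_eq0 sin2cos2 cwt expr1n subrr.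
have hc : \int[lebesgue_measure]_(t in `[0, tau])
            Re (to_complex (derive1 u) t * psi (- q) t) =
          w * \int[lebesgue_measure]_(t in `[0, tau])
            Im (to_complex u t * psi (- q) t).
  transitivity (\int[lebesgue_measure]_(t in `[0, tau]) (cos (w * t) * derive1 u t)).
    by apply: eq_Rintegral => t _; rewrite Re_mul/= -/w; ring.
  have dF t : is_derive t (1 : R) (fun t => cos (w * t)) (- w * sin (w * t)).
    by apply: is_derive_eq (is_derive_cosZ w t) _; rewrite mulNr.
  rewrite (circle_by_parts (k := fun t => sin (w * t)) dF)//.
  - rewrite mulNr opprK; congr (_ * _); apply: eq_Rintegral => t _.
    by rewrite Im_mul/= -/w; ring.
  - exact: continuous_sinZ.
  - by rewrite cwt mulr0 cos0.
have hs : \int[lebesgue_measure]_(t in `[0, tau])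
            Im (to_complex (derive1 u) t * psi (- q) t) =
          - (w * \int[lebesgue_measure]_(t in `[0, tau])
            Re (to_complex u t * psi (- q) t)).
  transitivity (\int[lebesgue_measure]_(t in `[0, tau]) (sin (w * t) * derive1 u t)).
    by apply: eq_Rintegral => t _; rewrite Im_mul/= -/w; ring.
  rewrite (circle_by_parts (k := fun t => cos (w * t)) (is_derive_sinZ w))//.
  - congr (- (_ * _)); apply: eq_Rintegral => t _.
    by rewrite Re_mul/= -/w; ring.
  - exact: continuous_cosZ.
  - by rewrite swt mulr0 sin0.
by rewrite hc hs wE; apply: complex_ext; rewrite ?Re_mul ?Im_mul /=; ring.
Qed.

Lemma continuous_bounded_L2 (u : R -> R) C : continuous u ->
  (forall t, `|u t| <= C) -> L2 (to_complex u).
Proof.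
move=> cu uC; apply: (L2_bounded tau_gt0 (C := C)) => [|t].
  split; first exact: continuous_measurable_fun.
  exact: measurable_cst.
by rewrite nc_real.
Qed.

(** The derivative of the constant 1 vanishes, hence so does [i omega q] times
    its coefficient of index [q]. *)
Lemma fourier_cst1 q : fourier (fun=> 1) q = (q == 0)%:R.
Proof.
have L1 : L2 (to_complex (fun=> 1 : R)).
  by apply: (@continuous_bounded_L2 _ 1) => [t|t]; [exact: cvg_cst|rewrite normr1].
case: eqP => [->|/eqP q0].
  rewrite fourierE oppr0; under eq_fun do rewrite psi0 mulr1.
  have -> : cintegral tau (fun=> 1) = tau%:C.
    apply: complex_ext; rewrite /cintegral/= /Rintegral.
      by rewrite integral_cst// circle_measureT//= mul1r.
    by rewrite integral0.
  by apply: complex_ext; rewrite ?Re_mul ?Im_mul/=; field; rewrite gt_eqF.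
have d1 : derive1 (fun=> 1 : R) = (fun=> 0 : R).
  by apply/funext => t; rewrite derive1_cst.
have := @fourier_derive1 (fun=> 1) q (fun=> derivable_cst _ _ _) _ erefl L1.
rewrite d1 => /(_ (fun=> cvg_cst _)) /(_ _)/=.
have L0 : L2 (to_complex (fun=> 0 : R)).
  by apply: (@continuous_bounded_L2 _ 0) => [t|t]; [exact: cvg_cst|rewrite normr0].
move=> /(_ L0).
have -> : fourier (to_complex (fun=> 0)) q = 0.
  have -> : to_complex (fun=> 0 : R) = (fun t => 0 * (fun=> 1) t).
    by apply/funext => t; rewrite mul0r.
  by rewrite (fourierZ tau_gt0 _ _ L1) mul0r.
move=> /esym/eqP; rewrite mulf_eq0 => /orP[|/eqP//].
rewrite eq_complex/= eqxx/= /Defs.omega.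
rewrite !mulf_eq0 invr_eq0 (gt_eqF tau_gt0) orbF pnatr_eq0/= gt_eqF ?pi_gt0//=.
by rewrite intr_eq0 (negPf q0).
Qed.

Lemma fourier_psi k q : fourier (psi k) q = (q == k)%:R.
Proof.
have -> : psi k = (fun t => (fun=> 1) t * psi k t).
  by apply/funext => t; rewrite mul1r.
by rewrite fourier_Mpsi fourier_cst1 subr_eq0.
Qed.

Definition sqnorm f : R := \int[mu]_t nc (f t) ^+ 2.

Lemma sqnorm_ge0 f : 0 <= sqnorm f.
Proof. by apply: Rintegral_ge0 => t _; exact: sqr_ge0. Qed.

(** Pythagoras: the component along [psi q] is orthogonal to what remains. *)
Lemma sqnorm_sub f q : L2 f ->
  sqnorm (fun t => f t - fourier f q * psi q t) =
  sqnorm f - tau * nc (fourier f q) ^+ 2.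
Proof.
move=> fl; set c := fourier f q.
have [mf fi] := (L2P tau f).1 fl.
have gl : L2 (fun t => f t * psi (- q) t) by exact: L2_Mpsi.
have [i1 i2] := L2_cintegrable tau_gt0 gl.
have cE : c = (tau^-1)%:C * cintegral tau (fun t => f t * psi (- q) t).
  by rewrite /c fourierE.
clearbody c.
have pt t : nc (f t - c * psi q t) ^+ 2 = nc (f t) ^+ 2 -
    (2 * Re c * Re (f t * psi (- q) t) + (2 * Im c * Im (f t * psi (- q) t) -
     nc c ^+ 2)).
  rewrite !sqr_nc !Re_add !Im_add !Re_opp !Im_opp !Re_mul !Im_mul psiN.
  rewrite /psi/= cosN sinN; have := cos2Dsin2 (omega q * t).
  move: (cos _) (sin _) => C S CS.
  have -> : Re c ^+ 2 + Im c ^+ 2 = (Re c ^+ 2 + Im c ^+ 2) * (C ^+ 2 + S ^+ 2).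
    by rewrite CS mulr1.
  by ring.
rewrite /sqnorm; under eq_Rintegral do rewrite pt.
have j1 : mu.-integrable setT (EFin \o (fun t => 2 * Re c * Re (f t * psi (- q) t))).
  exact: (integrableZl measurableT (2 * Re c) i1).
have j2 : mu.-integrable setT (EFin \o (fun t => 2 * Im c * Im (f t * psi (- q) t))).
  exact: (integrableZl measurableT (2 * Im c) i2).
have j0 := circle_integrable_cst tau_gt0 (nc c ^+ 2).
have j3 : mu.-integrable setT (EFin \o (fun t => 2 * Im c * Im (f t * psi (- q) t) - nc c ^+ 2)).
  exact: (integrableB measurableT j2 j0).
have j4 : mu.-integrable setT (EFin \o (fun t => 2 * Re c * Re (f t * psi (- q) t) +
   (2 * Im c * Im (f t * psi (- q) t) - nc c ^+ 2))).
  exact: (integrableD measurableT j1 j3).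
rewrite RintegralB// RintegralD// RintegralB//.
rewrite (RintegralZl _ measurableT i1) (RintegralZl _ measurableT i2).
rewrite Rintegral_cst// circle_measureT//= sqr_nc.
have -> : \int[mu]_t Re (f t * psi (- q) t) = tau * Re c.
  by rewrite cE Re_mul/= mul0r subr0 mulVKf ?gt_eqF.
have -> : \int[mu]_t Im (f t * psi (- q) t) = tau * Im c.
  by rewrite cE Im_mul/= mul0r addr0 mulVKf ?gt_eqF.
by ring.
Qed.

(** Removing the components of [f] one after the other lowers the squared norm
    by [tau * nc (fourier f q) ^+ 2] each time, without changing the
    coefficients still to be removed; the norm stays nonnegative. *)
Lemma bessel f s : L2 f -> uniq s ->
  tau * \sum_(q <- s) nc (fourier f q) ^+ 2 <= sqnorm f.
Proof.
elim: s f => [|q s IH] f fl; first by rewrite big_nil mulr0 sqnorm_ge0.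
move=> /= /andP[qs us].
have gl : L2 (fun t => fourier f q * psi q t) by apply: L2Z => //; exact: L2_psi.
have := IH _ (L2B fl gl) us; rewrite sqnorm_sub// lerBrDr addrC => h.
rewrite big_cons mulrDr; apply: le_trans h; rewrite lerD2l.
rewrite le_eqVlt; apply/orP; left; apply/eqP; congr (_ * _).
apply: eq_big_seq => p ps; rewrite fourierB// (fourierZ tau_gt0 _ _ (L2_psi _ _))//.
rewrite fourier_psi (_ : p == q = false) ?mulr0 ?subr0//.
by apply: contraNF qs => /eqP <-.
Qed.

Lemma fourier_l2 f : L2 f -> l2 (fourier f).
Proof.
move=> fl; apply/l2P; exists (sqnorm f / tau) => s us.
by rewrite ler_pdivlMr// mulrC bessel.
Qed.

Lemma sqnorm_le f C : cmeas f -> (forall t, nc (f t) <= C) ->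
  sqnorm f <= C ^+ 2 * tau.
Proof.
move=> mf fC; have fl := L2_bounded tau_gt0 mf fC.
have [_ fi] := (L2P tau f).1 fl.
have := @le_Rintegral _ _ _ mu setT _ (fun=> C ^+ 2) measurableT fi
  (circle_integrable_cst tau_gt0 (C ^+ 2)).
rewrite Rintegral_cst// circle_measureT//=; apply => t _.
by rewrite lerXn2r ?nnegrE ?nc_ge0//; exact: le_trans (nc_ge0 _) (fC t).
Qed.

Lemma fourier_bound f q C : cmeas f -> (forall t, nc (f t) <= C) ->
  nc (fourier f q) <= C.
Proof.
move=> mf fC; have C0 : 0 <= C by exact: le_trans (nc_ge0 _) (fC 0).
have fl := L2_bounded tau_gt0 mf fC.
have := le_trans (@bessel f [:: q] fl erefl) (sqnorm_le mf fC).
by rewrite big_seq1 mulrC ler_pM2r// ler_sqr ?nnegrE ?nc_ge0.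
Qed.

Lemma L2normE f : L2 f -> L2norm tau f = (Num.sqrt (sqnorm f))%:E.
Proof.
move=> fl; have [_ fi] := (L2P tau f).1 fl.
rewrite /L2norm unlock.
have -> : (\int[mu]_x `|(nc (f x))%:E| `^ 2 = (sqnorm f)%:E)%E.
  rewrite /sqnorm /Rintegral fineK; last exact: integrable_fin_num.
  apply: eq_integral => t _; rewrite /= ?poweR_EFin powR_mulrn//.
  by rewrite ger0_norm// nc_ge0.
by rewrite poweR_EFin powR12_sqrt// sqnorm_ge0.
Qed.

Lemma L2_converges_sqnorm (f_ : nat -> R -> R[i]) f :
  (forall M, L2 (f_ M)) -> L2 f -> L2_converges tau f_ f ->
  sqnorm (fun t => f_ M t - f t) @[M --> \oo] --> 0.
Proof.
move=> fM fl; rewrite /L2_converges.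
have -> : (fun M => L2norm tau (fun t => f_ M t - f t)) =
    (fun M => (Num.sqrt (sqnorm (fun t => f_ M t - f t)))%:E).
  by apply/funext => M; rewrite L2normE//; exact: L2B.
move=> /fine_cvg h0.
have h : Num.sqrt (sqnorm (fun t => f_ M t - f t)) @[M --> \oo] --> (0 : R).
  exact: h0.
have -> : (fun M => sqnorm (fun t => f_ M t - f t)) =
    (fun M => Num.sqrt (sqnorm (fun t => f_ M t - f t)) *
              Num.sqrt (sqnorm (fun t => f_ M t - f t))).
  by apply/funext => M; rewrite -expr2 sqr_sqrtr// sqnorm_ge0.
by rewrite -[X in _ --> X](mulr0 (0 : R)); exact: cvgM.
Qed.

End Bessel.

(** * Uniqueness of Fourier coefficients *)

Section Approximation.
Variable R : realType.
Implicit Types y z : R.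

Lemma bernoulli_pos z k : 0 <= z -> 1 + k%:R * z <= (1 + z) ^+ k.
Proof.
move=> z0; elim: k => [|k IH]; first by rewrite mul0r addr0 expr0.
rewrite exprS; apply: (@le_trans _ _ ((1 + z) * (1 + k%:R * z))).
  rewrite -natr1; have : 0 <= k%:R * z ^+ 2 by rewrite mulr_ge0 ?sqr_ge0.
  by nra.
by rewrite ler_wpM2l// addr_ge0.
Qed.

Lemma bernoulli_neg z k : 0 <= z <= 1 -> 1 - k%:R * z <= (1 - z) ^+ k.
Proof.
move=> /andP[z0 z1]; elim: k => [|k IH]; first by rewrite mul0r subr0 expr0.
rewrite exprS; apply: (@le_trans _ _ ((1 - z) * (1 - k%:R * z))).
  rewrite -natr1; have : 0 <= k%:R * z ^+ 2 by rewrite mulr_ge0 ?sqr_ge0.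
  by nra.
by rewrite ler_wpM2l// subr_ge0.
Qed.

(** On [0, 1] these polynomials converge boundedly to the indicator function of
    [y < 1/2], away from [y = 1/2]: by Bernoulli's inequality [cutoff n y] is at
    least [1 - (2 y)^n] and at most [(2 y)^-n]. *)
Definition cutoff n y : R := (1 - y ^+ n) ^+ (2 ^ n).

Lemma cutoff_ge0 n y : 0 <= y <= 1 -> 0 <= cutoff n y.
Proof.
by move=> /andP[y0 y1]; rewrite /cutoff exprn_ge0// subr_ge0 exprn_ile1.
Qed.

Lemma cutoff_le1 n y : 0 <= y <= 1 -> cutoff n y <= 1.
Proof.
move=> /andP[y0 y1]; rewrite /cutoff exprn_ile1// ?subr_ge0 ?exprn_ile1//.
by rewrite lerBlDr lerDl exprn_ge0.
Qed.

Lemma cutoff_below y : 0 <= y < 2^-1 -> cutoff n y @[n --> \oo] --> (1 : R).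
Proof.
move=> /andP[y0 y2].
have y1 : 0 <= y <= 1 by rewrite y0/=; lra.
apply: (@squeeze_cvgr _ _ _ _ (fun n => 1 - (2 * y) ^+ n) (fun=> 1)).
- apply: nearW => n; rewrite cutoff_le1// andbT.
  have -> : (2 * y) ^+ n = (2 ^ n)%:R * y ^+ n by rewrite exprMn natrX.
  by apply: bernoulli_neg; case/andP: y1 => _ ?; rewrite exprn_ge0// exprn_ile1.
- rewrite -[X in _ --> X]subr0; apply: cvgB; first exact: cvg_cst.
  by apply: cvg_expr; rewrite ger0_norm; lra.
- exact: cvg_cst.
Qed.

Lemma cutoff_above y : 2^-1 < y <= 1 -> cutoff n y @[n --> \oo] --> (0 : R).
Proof.
move=> /andP[y2 y1].
have y0 : 0 < y by apply: lt_trans y2; rewrite invr_gt0.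
have y01 : 0 <= y <= 1 by rewrite (ltW y0).
apply: (@squeeze_cvgr _ _ _ _ (fun=> 0) (fun n => (2 * y)^-1 ^+ n)).
- apply: nearW => n; rewrite cutoff_ge0//=.
  have z0 : 0 <= y ^+ n by rewrite exprn_ge0// ltW.
  have z1 : y ^+ n <= 1 by rewrite exprn_ile1// ltW.
  have -> : (2 * y)^-1 ^+ n = ((2 ^ n)%:R * y ^+ n)^-1.
    by rewrite exprVn exprMn natrX.
  rewrite -[leRHS]mul1r ler_pdivlMr; last first.
    by rewrite mulr_gt0 ?exprn_gt0// ltr0n expn_gt0.
  apply: (@le_trans _ _ ((1 - y ^+ n) ^+ (2 ^ n) * (1 + y ^+ n) ^+ (2 ^ n))).
    rewrite ler_wpM2l ?exprn_ge0 ?subr_ge0//.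
    by apply: le_trans (bernoulli_pos _ z0); rewrite lerDr.
  rewrite -exprMn exprn_ile1//; first by nra.
  by have := sqr_ge0 (y ^+ n); nra.
- exact: cvg_cst.
- by apply: cvg_expr; rewrite ger0_norm ?invr_ge0 ?invf_lt1; lra.
Qed.

End Approximation.

Section Uniqueness.
Variables (R : realType) (tau : R).
Hypothesis tau_gt0 : 0 < tau.
Implicit Types f g h : R -> R[i].

Local Notation mu := (circle_measure tau).
Local Notation fourier := (fourier tau).
Local Notation psi := (psi tau).
Local Notation L2 := (L2 tau).
Local Notation ae_equal := (ae_equal tau).

(** Trigonometric polynomials act by multiplication on the functions without
    Fourier coefficients; this is how test functions are brought in. *)
Definition fourier_null h := L2 h /\ forall q, fourier h q = 0.

Lemma fourier_null_psi h k : fourier_null h -> fourier_null (fun t => h t * psi k t).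
Proof.
by move=> [hl h0]; split=> [|q]; [exact: L2_Mpsi|rewrite fourier_Mpsi].
Qed.

Lemma fourier_null_lin a h g : fourier_null h -> fourier_null g ->
  fourier_null (fun t => a * h t + g t).
Proof.
move=> [hl h0] [gl g0]; have al := L2Z a hl.
by split=> [|q]; [exact: L2D|rewrite fourierD// fourierZ// h0 g0 mulr0 addr0].
Qed.

(** A trigonometric polynomial with values in [0, 1]. For [x] and [t] strictly
    between 0 and [tau], it is smaller than 1/2 exactly when [t] is on the left
    of [x]: the first sine is positive and the second one has the sign of
    [x - t]. *)
Definition sweep (x t : R) : R :=
  (1 - sin (pi * t / tau) * sin (pi * (x - t) / tau)) / 2.

Lemma sweep01 x t : 0 <= sweep x t <= 1.
Proof.
have sle (z : R) : -1 <= sin z <= 1 by rewrite sin_geN1 sin_le1.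
have := sle (pi * t / tau); have := sle (pi * (x - t) / tau).
rewrite /sweep; move: (sin _) (sin _) => a b /andP[a1 a2] /andP[b1 b2].
by apply/andP; split; nra.
Qed.

(** The product of the two sines has only the frequencies 0, 1 and -1, by the
    product-to-sum formula. *)
Lemma sweep_psi x t : let phi := pi * x / tau in
  (sweep x t)%:C = (2^-1 + cos phi / 4)%:C +
    (- (8^-1)%:C * expi (- phi)) * psi 1 t + (- (8^-1)%:C * expi phi) * psi (- 1) t.
Proof.
move=> phi; set th := pi * t / tau.
have -> : psi 1 t = expi (th + th).
  by rewrite /psi/= /Defs.omega /th; congr expi; ring.
have -> : psi (- 1) t = expi (- (th + th)).
  by rewrite psiN /Defs.omega /th; congr (expi (- _)); ring.
rewrite /sweep -/th (_ : pi * (x - t) / tau = phi - th); last first.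
  by rewrite /phi /th; ring.
have := cos2Dsin2 th; clearbody phi th.
rewrite sinB /expi !cosN !sinN cosD sinD.
move: (cos th) (sin th) (cos phi) (sin phi) => C S D E CS.
have C2 : C ^+ 2 = 1 - S ^+ 2 by rewrite -CS addrK.
apply: complex_ext; rewrite ?Re_add ?Im_add ?Re_mul ?Im_mul ?Re_add ?Im_add ?Re_mul ?Im_mul/=.
  have -> : C * C = 1 - S ^+ 2 by rewrite -C2 expr2.
  by field.
by field.
Qed.

Lemma fourier_null_sweep h x : fourier_null h ->
  fourier_null (fun t => h t * (sweep x t)%:C).
Proof.
move=> hn; set phi := pi * x / tau.
have -> : (fun t => h t * (sweep x t)%:C) = (fun t =>
    (2^-1 + cos phi / 4)%:C * h t +
    ((- (8^-1)%:C * expi (- phi)) * (h t * psi 1 t) +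
     ((- (8^-1)%:C * expi phi) * (h t * psi (- 1) t) + 0 * h t))).
  by apply/funext => t; rewrite sweep_psi -/phi; ring.
apply: fourier_null_lin => //; apply: fourier_null_lin.
  exact: fourier_null_psi.
apply: fourier_null_lin; first exact: fourier_null_psi.
have -> : (fun t => 0 * h t) = (fun t => -1 * h t + h t).
  by apply/funext => t; rewrite mul0r mulN1r addNr.
exact: fourier_null_lin.
Qed.

Lemma fourier_null_pow h x n : fourier_null h ->
  fourier_null (fun t => h t * (sweep x t ^+ n)%:C).
Proof.
move=> hn; elim: n => [|n IH].
  by under eq_fun do rewrite expr0 mulr1.
have := fourier_null_sweep x IH; congr fourier_null; apply/funext => t.
by rewrite exprSr real_complexM mulrA.
Qed.

Lemma fourier_null_cutoff h x n : fourier_null h ->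
  fourier_null (fun t => h t * (cutoff n (sweep x t))%:C).
Proof.
move=> hn; rewrite /cutoff; elim: (2 ^ n)%N => [|k IH].
  by under eq_fun do rewrite expr0 mulr1.
have := fourier_null_lin (-1) (fourier_null_pow x n IH) IH.
congr fourier_null; apply/funext => t.
by rewrite exprSr real_complexM real_complexB; ring.
Qed.

Lemma measurable_sweep x : measurable_fun setT (sweep x).
Proof.
have ms : measurable_fun setT (@sin R).
  by apply: continuous_measurable_fun => z; exact: continuous_sin.
apply: measurable_funM => //; apply: measurable_funB => //.
apply: measurable_funM; apply: (measurableT_comp ms);
  apply: measurable_funM => //; apply: measurable_funM => //.
exact: measurable_funB.
Qed.

Lemma measurable_cutoff x n : measurable_fun setT (fun t => cutoff n (sweep x t)).
Proof.
apply: measurable_funX; apply: measurable_funB => //.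
by apply: measurable_funX; exact: measurable_sweep.
Qed.

(** The polynomials [cutoff n (sweep x t)] in [psi 1 t] and [psi (- 1) t]
    approximate the indicator function of the interval from 0 to [x]. *)
Lemma cutoff_sweep_cvg x t : 0 < x < tau -> 0 < t < tau -> t != x ->
  cutoff n (sweep x t) @[n --> \oo] --> ((t < x)%R%:R : R).
Proof.
move=> /andP[x0 xT] /andP[t0 tT] tx.
have pit : 0 < sin (pi * t / tau).
  apply: sin_gt0_pi; rewrite divr_gt0 ?mulr_gt0 ?pi_gt0//=.
  by rewrite ltr_pdivrMr// ltr_pM2l ?pi_gt0.
have /andP[y0 y1] := sweep01 x t.
case: ltP => [ltx|lex].
  apply: cutoff_below; rewrite y0/=.
  have : 0 < sin (pi * (x - t) / tau).
    apply: sin_gt0_pi; rewrite divr_gt0 ?mulr_gt0 ?pi_gt0 ?subr_gt0//=.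
    by rewrite ltr_pdivrMr// ltr_pM2l ?pi_gt0//; lra.
  by rewrite /sweep => s0; have := mulr_gt0 pit s0; lra.
apply: cutoff_above; rewrite y1 andbT.
have {}lex : x < t by rewrite lt_neqAle eq_sym tx.
have : 0 < sin (pi * (t - x) / tau).
  apply: sin_gt0_pi; rewrite divr_gt0 ?mulr_gt0 ?pi_gt0 ?subr_gt0//=.
  by rewrite ltr_pdivrMr// ltr_pM2l ?pi_gt0//; lra.
rewrite (_ : pi * (t - x) / tau = - (pi * (x - t) / tau)); last by ring.
by rewrite sinN /sweep => s0; have := mulr_gt0 pit s0; lra.
Qed.

Lemma circle_ae_interior (P : R -> Prop) (x : R) :
  (forall t, 0 < t < tau -> t != x -> P t) -> {ae mu, forall t, P t}.
Proof.
move=> H; apply: circle_measure_ae; exists ([set 0] `|` [set x]); split.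
- by apply: measurableU; exact: measurable_set1.
- apply: countable_lebesgue_measure0; apply: finite_set_countable.
  by rewrite finite_setU; split; exact: finite_set1.
- move=> t /= /not_implyP[/andP[t0 tT] nP].
  have [->|tn0] := eqVneq t 0; first by left.
  have [->|tnx] := eqVneq t x; first by right.
  by exfalso; apply: nP; apply: H => //; rewrite tT andbT lt_neqAle eq_sym tn0.
Qed.

Lemma measurable_ltnum (x : R) :
  measurable_fun setT (fun t : R => (t < x)%R%:R : R).
Proof.
have -> : (fun t : R => (t < x)%R%:R : R) = \1_(`]-oo, x[%classic).
  by apply/funext => t; rewrite indicE mem_setE/= in_itv.
by apply: measurable_indic; exact: measurable_itv.
Qed.

Lemma cutoff_integral_lim (u : R -> R) x : 0 < x < tau ->
  mu.-integrable setT (EFin \o u) ->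
  (forall n, \int[mu]_t (u t * cutoff n (sweep x t)) = 0) ->
  \int[mu]_t (u t * (t < x)%R%:R) = 0.
Proof.
move=> xT ui u0; have mu_ : measurable_fun setT u.
  by apply/measurable_EFinP; case/integrableP : ui.
have mx := measurable_ltnum x.
have mn n : measurable_fun setT (fun t => (u t * cutoff n (sweep x t))%:E).
  by apply/measurable_EFinP; apply: measurable_funM => //; exact: measurable_cutoff.
have ml : measurable_fun setT (fun t => (u t * (t < x)%R%:R)%:E).
  by apply/measurable_EFinP; exact: measurable_funM.
have cv : {ae mu, forall t, setT t ->
    (u t * cutoff n (sweep x t))%:E @[n --> \oo] --> (u t * (t < x)%R%:R)%:E}.
  apply: (@circle_ae_interior _ x) => t tT tx _; apply/fine_cvgP; split.
    exact: nearW.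
  by apply: cvgM; [exact: cvg_cst|exact: cutoff_sweep_cvg].
have dom : {ae mu, forall t n, setT t ->
    (`|(u t * cutoff n (sweep x t))%:E| <= `|(u t)%:E|)%E}.
  apply: aeW => t n _; rewrite lee_fin normrM ler_piMr//.
  by rewrite ger0_norm ?cutoff_ge0 ?cutoff_le1// sweep01.
have [_ _] := @dominated_convergence _ _ _ mu setT measurableT
  (fun n t => (u t * cutoff n (sweep x t))%:E) (fun t => (u t * (t < x)%R%:R)%:E)
  _ mn ml cv (integrable_abse ui) dom.
have -> : [sequence (\int[mu]_t (u t * cutoff n (sweep x t))%:E)%E]_n = (fun=> 0%E).
  apply/funext => n /=; have := u0 n; rewrite /Rintegral => un.
  rewrite -[LHS]fineK ?un//; apply: integrable_fin_num => //.
  apply: (le_integrable measurableT _ _ ui); first exact: mn.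
  move=> t _ /=; rewrite lee_fin normrM ler_piMr//.
  by rewrite ger0_norm ?cutoff_ge0 ?cutoff_le1// sweep01.
move=> /cvg_lim; rewrite lim_cst// => h.
by rewrite /Rintegral -h.
Qed.

(** The hypothesis says that the primitive of [u] vanishes; by Lebesgue's
    differentiation theorem its derivative is [u] almost everywhere. *)
Lemma ae0_of_primitive (u : R -> R) : mu.-integrable setT (EFin \o u) ->
  (forall x, 0 < x < tau -> \int[mu]_t (u t * (t < x)%R%:R) = 0) ->
  {ae mu, forall t, u t = 0}.
Proof.
move=> ui u0.
have uiT := circle_integrable ui.
pose v := u \_ `[0, tau[%classic.
have vi : lebesgue_measure.-integrable setT (EFin \o v).
  by rewrite /v -restrict_EFin; apply/integrable_restrict => //; rewrite setTI.
have := @FTC1Ny R v _ _.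
have vy y : lebesgue_measure.-integrable `]-oo, y] (EFin \o v).
  exact: integrableS vi.
move=> /(_ vy (open_integrable_locally openT vi)) /= H.
have F0 x : 0 < x < tau -> \int[lebesgue_measure]_(t in `]-oo, x]) v t = 0.
  move=> xT; rewrite -Rintegral_itv_bndo_bndc; last exact: integrableS vi.
  rewrite -(u0 x xT) Rintegral_mkcond /Rintegral.
  have wi : mu.-integrable setT (EFin \o (fun t => u t * (t < x)%R%:R)).
    apply: (le_integrable measurableT _ _ ui).
      apply/measurable_EFinP; apply: measurable_funM; last exact: measurable_ltnum.
      by apply/measurable_EFinP; case/integrableP : ui.
    move=> t _ /=; rewrite lee_fin normrM ler_piMr//.
    by case: ltP => _; rewrite ?normr1 ?normr0.
  rewrite circle_integral// [in RHS]integral_mkcond; congr fine.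
  apply: eq_integral => t _; rewrite /v !patchE/= !mem_setE !in_itv/=.
  by case: ifP; case: ifP; rewrite ?mulr1 ?mulr0 ?mul0r// => -> //.
apply: circle_measure_ae.
have Z : {ae lebesgue_measure, forall t : R, t != 0}.
  exists [set 0]; split => [||t /= /negP/negPn/eqP//].
    exact: measurable_set1.
  exact: lebesgue_measure_set1.
have FF := ae_filter_ringOfSetsType (@lebesgue_measure R).
apply: filterS2 H Z => x [_ dF] xn0 /andP[x0 xT].
have {}x0 : 0 < x by rewrite lt_neqAle eq_sym xn0.
have vx : v x = u x by rewrite /v patchE mem_setE in_itv/= (ltW x0) xT.
rewrite -vx -dF derive1E.
rewrite (@near_eq_derive _ _ _ _ (fun=> 0)) ?derive_cst//.
near=> y; apply: F0; apply/andP; split; near: y.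
  exact: lt_nbhsr.
exact: lt_nbhsl.
Unshelve. all: by end_near. Qed.

(** Multiplying [h] by [cutoff n (sweep x t)] creates no Fourier coefficient, so
    the integrals of these products are zero; by dominated convergence the
    integral of [h] over every interval from 0 to [x] is zero as well. *)
Theorem fourier_unique0 h : L2 h -> (forall q, fourier h q = 0) ->
  ae_equal h (fun=> 0).
Proof.
move=> hl h0; have hn : fourier_null h by [].
have [ri ii] := L2_cintegrable tau_gt0 hl.
have T0 x n : cintegral tau (fun t => h t * (cutoff n (sweep x t))%:C) = 0.
  have [_ /(_ 0)] := fourier_null_cutoff x n hn.
  rewrite fourierE oppr0; under eq_fun do rewrite psi0 mulr1.
  move=> /eqP; rewrite mulf_eq0 => /orP[|/eqP//].
  by rewrite eq_complex/= invr_eq0 gt_eqF.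
have rn : {ae mu, forall t, Re (h t) = 0}.
  apply: ae0_of_primitive => // x xT; apply: cutoff_integral_lim => // n.
  have := congr1 (@complex.Re R) (T0 x n); rewrite /cintegral/= => <-.
  by apply: eq_Rintegral => t _; rewrite Re_mul/= mulr0 subr0.
have in_ : {ae mu, forall t, Im (h t) = 0}.
  apply: ae0_of_primitive => // x xT; apply: cutoff_integral_lim => // n.
  have := congr1 (@complex.Im R) (T0 x n); rewrite /cintegral/= => <-.
  by apply: eq_Rintegral => t _; rewrite Im_mul/= mulr0 add0r.
have FF := ae_filter_ringOfSetsType mu.
by apply: filterS2 rn in_ => t hr hi _; apply: complex_ext.
Qed.

Theorem fourier_unique f g : L2 f -> L2 g -> fourier f = fourier g ->
  ae_equal f g.
Proof.
move=> fl gl fg.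
have : ae_equal (fun t => f t - g t) (fun=> 0).
  apply: fourier_unique0; first exact: L2B.
  by move=> q; rewrite fourierB// fg subrr.
by apply: filterS => t /= + _ => /(_ I) /eqP; rewrite subr_eq0 => /eqP.
Qed.

End Uniqueness.

(** * Absolutely convergent Fourier series *)

Section AbsolutelyConvergent.
Variables (R : realType) (tau : R).
Hypothesis tau_gt0 : 0 < tau.
Implicit Types (f g h : R -> R[i]) (a b : int -> R[i]).

Local Notation mu := (circle_measure tau).
Local Notation fourier := (fourier tau).
Local Notation psi := (psi tau).
Local Notation L2 := (L2 tau).
Local Notation ae_equal := (ae_equal tau).
Local Notation sqnorm := (sqnorm tau).

Lemma le0_of_tail (x C : R) (r : nat -> R) N0 : r N @[N --> \oo] --> 0 ->
  (forall N, (N0 <= N)%N -> x <= C * r N) -> x <= 0.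
Proof.
move=> r0 xr; have /cvgr_to_ge : C * r N @[N --> \oo] --> C * 0.
  by apply: cvgM => //; exact: cvg_cst.
by rewrite mulr0; apply; exists N0.
Qed.

Definition synth a t : R[i] := Zsum (fun q => a q * psi q t).

Definition synth_part a N t : R[i] := symsum (fun q => a q * psi q t) N.

Lemma nc_Mpsi a q t : nc (a q * psi q t) = nc (a q).
Proof. by rewrite Normc.normcM nc_psi mulr1. Qed.

Lemma synth_tail a : l1 a -> exists r : nat -> R,
  [/\ r N @[N --> \oo] --> 0, (forall N, 0 <= r N) &
      forall N t, nc (synth_part a N t - synth a t) <= r N].
Proof.
move=> /l1_tail[r [r0 rp ar]]; exists r; split=> // N t.
apply: Zsum_tail r0 _ N => N s us sN; apply: le_trans (ar N s us sN).
by apply: ler_sum => q _; rewrite nc_Mpsi.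
Qed.

Lemma synth_bounded a : l1 a -> exists C, forall t, nc (synth a t) <= C.
Proof.
move=> /l1P[C aC]; exists C => t; apply: Zsum_le => s us.
by apply: le_trans (aC s us); apply: ler_sum => q _; rewrite nc_Mpsi.
Qed.

Lemma L2_synth_part a N : L2 (synth_part a N).
Proof. by apply: L2_sum => // q; apply: L2Z; exact: L2_psi. Qed.

Lemma cmeas_synth a : l1 a -> cmeas (synth a).
Proof.
move=> la; have cv t : nc (synth_part a N t - synth a t) @[N --> \oo] --> 0.
  apply: Zsum_cvg; apply: l1_le la _ => q.
  by rewrite nc_Mpsi.
have mp N := L2_cmeas (L2_synth_part a N).
split.
  apply: (measurable_fun_cvg (h := fun N t => Re (synth_part a N t))).
    by move=> N; have [] := mp N.
  by move=> t _; have [] := nc_cvg0_ReIm (cv t).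
apply: (measurable_fun_cvg (h := fun N t => Im (synth_part a N t))).
  by move=> N; have [] := mp N.
by move=> t _; have [] := nc_cvg0_ReIm (cv t).
Qed.

Lemma L2_synth a : l1 a -> L2 (synth a).
Proof.
move=> la; have [C aC] := synth_bounded la.
exact: (L2_bounded tau_gt0 (cmeas_synth la) aC).
Qed.

Lemma fourier_synth_part a N q :
  fourier (synth_part a N) q = if q \in window N then a q else 0.
Proof.
rewrite fourier_sum//; last by move=> k; apply: L2Z; exact: L2_psi.
transitivity (\sum_(k <- window N) a k * (q == k)%:R).
  apply: eq_bigr => k _; rewrite fourierZ//; last exact: L2_psi.
  by rewrite fourier_psi.
have [qN|qN] := boolP (q \in window N).
  rewrite (bigD1_seq _ qN (window_uniq N))/= eqxx mulr1 big1 ?addr0// => k kq.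
  by rewrite eq_sym (negPf kq) mulr0.
rewrite big1_seq// => k /= kN; case: eqP => [qk|]; last by rewrite mulr0.
by rewrite qk kN in qN.
Qed.

Lemma fourier_synth a : l1 a -> fourier (synth a) = a.
Proof.
move=> la; have [r [r0 rp ar]] := synth_tail la.
have sl := L2_synth la.
apply/funext => q; apply/eqP; rewrite -subr_eq0 -nc_eq0 eq_le nc_ge0 andbT.
apply: (le0_of_tail (C := 1) (N0 := `|q|%N) r0) => N qN; rewrite mul1r.
have -> : a q = fourier (synth_part a N) q.
  by rewrite fourier_synth_part mem_window qN.
rewrite nc_sub -fourierB//; last exact: L2_synth_part.
apply: fourier_bound => //; apply: L2_cmeas; apply: L2B; last exact: sl.
exact: L2_synth_part.
Qed.

(** The Wiener algebra of the circle, each member with its coefficients. It is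
    the class in which a pointwise product of functions can be computed from
    the coefficients alone. *)
Definition wiener f a := [/\ L2 f, l1 a & fourier f = a].

(** Both sides have the same Fourier coefficients. This replaces an arbitrary
    representative by a bounded one. *)
Lemma wiener_synth f a : wiener f a -> ae_equal f (synth a).
Proof.
move=> [fl la fa]; apply: fourier_unique => //; first exact: L2_synth.
by rewrite fourier_synth.
Qed.

(** If the second factor is a partial sum, the coefficient is a finite sum of
    shifted coefficients of [synth a]. The partial sums converge uniformly and
    [synth a] is bounded, so the coefficients converge too. *)
Lemma fourier_mul_synth a b q : l1 a -> l1 b ->
  fourier (fun t => synth a t * synth b t) q = conv a b q.
Proof.
move=> la lb; symmetry; apply: Zsum_lim.
have [C aC] := synth_bounded la; have [r [r0 rp br]] := synth_tail lb.
have Crp : C * r N @[N --> \oo] --> 0.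
  by rewrite -(mulr0 C); apply: cvgM => //; exact: cvg_cst.
apply: (squeeze_cvgr _ (cvg_cst 0) Crp); apply: nearW => N; rewrite nc_ge0/=.
have [ma mb] := (cmeas_synth la, cmeas_synth lb).
have al := L2_synth la.
have mp := L2_cmeas (L2_synth_part b N).
have lk k : L2 (fun t => b k * (synth a t * psi k t)).
  by apply: L2Z; exact: L2_Mpsi.
have -> : symsum (fun k => a (q - k) * b k) N =
    fourier (fun t => synth a t * synth_part b N t) q.
  transitivity (fourier (fun t => \sum_(k <- window N) b k * (synth a t * psi k t)) q).
    rewrite fourier_sum//; apply: eq_bigr => k _.
    rewrite fourierZ ?fourier_Mpsi ?fourier_synth// 1?mulrC//.
    exact: L2_Mpsi.
  congr (fourier _ q); apply/funext => t; rewrite /synth_part /symsum mulr_sumr.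
  by apply: eq_bigr => k _; rewrite mulrCA.
have l1' : L2 (fun t => synth a t * synth_part b N t).
  apply: (L2_dom (f := synth_part b N) (C := C)) => //.
  - exact: L2_synth_part.
  - exact: cmeasM.
  - by move=> t; rewrite Normc.normcM ler_wpM2r ?nc_ge0.
have l2' : L2 (fun t => synth a t * synth b t).
  apply: (L2_dom (f := synth b) (C := C)) => //.
  - exact: L2_synth.
  - exact: cmeasM.
  - by move=> t; rewrite Normc.normcM ler_wpM2r ?nc_ge0.
rewrite -fourierB//; apply: fourier_bound => //.
  exact: L2_cmeas (L2B l1' l2').
move=> t; rewrite -mulrBr Normc.normcM ler_pM ?nc_ge0//.
Qed.

Lemma wiener_mul f g a b : wiener f a -> wiener g b ->
  wiener (fun t => f t * g t) (conv a b).
Proof.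
move=> fa gb; have fs := wiener_synth fa; have gs := wiener_synth gb.
have [fl la _] := fa; have [gl lb _] := gb.
have [C aC] := synth_bounded la.
have sl : L2 (fun t => synth a t * synth b t).
  apply: (L2_dom (f := synth b) (C := C)) => //.
  - exact: L2_synth.
  - by apply: cmeasM; exact: cmeas_synth.
  - by move=> t; rewrite Normc.normcM ler_wpM2r ?nc_ge0.
have FF := ae_filter_ringOfSetsType mu.
have fgs : ae_equal (fun t => f t * g t) (fun t => synth a t * synth b t).
  by apply: filterS2 fs gs => t /= ef eg _; rewrite ef ?eg.
have fgl : L2 (fun t => f t * g t).
  apply: ae_cmeas_L2 fgs _ sl.
  exact: cmeasM (L2_cmeas fl) (L2_cmeas gl).
split=> //; first exact: l1_conv.
rewrite (fourier_ae fgl sl fgs); apply/funext => q.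
exact: fourier_mul_synth.
Qed.

Lemma sqnorm_bounded (A : (R -> R[i]) -> R -> R[i]) : bounded_linear_map tau A ->
  exists2 c, 0 <= c & forall f, L2 f -> sqnorm (A f) <= c ^+ 2 * sqnorm f.
Proof.
move=> [[AL _ _] [c Ac]]; exists `|c| => // f fl.
have := Ac f fl; rewrite (L2normE (AL _ fl)) (L2normE fl) -EFinM lee_fin => h.
rewrite -normrX ger0_norm ?sqr_ge0//.
rewrite -[leLHS](sqr_sqrtr (sqnorm_ge0 tau _)) -[X in _ <= _ * X](sqr_sqrtr (sqnorm_ge0 tau _)).
rewrite -exprMn lerXn2r ?nnegrE ?sqrtr_ge0//.
exact: le_trans (sqrtr_ge0 _) h.
Qed.

(** The operator acts on representatives, so that even its value at the zero
    function is only zero almost everywhere. *)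
Lemma linear_map_sum (A : (R -> R[i]) -> R -> R[i]) (I : Type) (s : seq I)
    (c : I -> R[i]) (F : I -> R -> R[i]) : linear_map tau A ->
  (forall i, L2 (F i)) ->
  ae_equal (A (fun t => \sum_(i <- s) c i * F i t))
           (fun t => \sum_(i <- s) c i * A (F i) t).
Proof.
move=> [AL Aae Alin] FL; have FF := ae_filter_ringOfSetsType mu.
elim: s => [|i s IH].
  have L0 : L2 (fun=> 0) by exact: L2_cst.
  have := Alin (-1) _ _ L0 L0.
  have -> : (fun t : R => -1 * 0 + 0 : R[i]) = (fun=> 0).
    by apply/funext => t; rewrite mulr0 addr0.
  have -> : (fun t : R => \sum_(i <- [::]) c i * F i t) = (fun=> 0).
    by apply/funext => t; rewrite big_nil.
  by apply: filterS => t /= + _ => -> //; rewrite big_nil mulN1r addNr.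
have sL : L2 (fun t => \sum_(i <- s) c i * F i t).
  by apply: L2_sum => // j; exact: L2Z.
have := Alin (c i) _ _ (FL i) sL.
have -> : (fun t => \sum_(j <- i :: s) c j * F j t) =
          (fun t => c i * F i t + \sum_(j <- s) c j * F j t).
  by apply/funext => t; rewrite big_cons.
by apply: filterS2 IH => t /= e1 e2 _; rewrite e2// e1// big_cons.
Qed.

Section Multiplier.
Variable A : (R -> R[i]) -> R -> R[i].
Hypothesis A_bounded : bounded_linear_map tau A.
Hypothesis A_eigen : forall q, psi_eigenvector tau (op_graph tau A) q.
Let m := symbol tau (op_graph tau A).

Lemma symbol_eigen q : ae_equal (fun t => m q * psi q t) (A (psi q)).
Proof.
have [l Al] := A_eigen q.
suff [] : op_graph tau A (psi q) (fun t => m q * psi q t) by [].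
exact: (@xgetPex _ 0 [set l | op_graph tau A (psi q) (fun t => l * psi q t)]
  (ex_intro _ l Al)).
Qed.

Lemma fourier_op q k : fourier (A (psi q)) k = m q * (k == q)%:R.
Proof.
have [[AL _ _] _] := A_bounded.
rewrite -(fourier_ae _ _ (symbol_eigen q)).
- by rewrite fourierZ ?fourier_psi//; exact: L2_psi.
- by apply: L2Z; exact: L2_psi.
- by apply: AL; exact: L2_psi.
Qed.

(** The coefficient of [A (psi q)] along [psi q] is the symbol, and Bessel's
    inequality bounds it by the norm of [A (psi q)]. *)
Lemma symbol_bounded : exists c, forall q, nc (m q) <= c.
Proof.
have [c c0 Ac] := sqnorm_bounded A_bounded; exists c => q.
have [[AL _ _] _] := A_bounded.
have pl := L2_psi tau_gt0 q.
have := bessel tau_gt0 (AL _ pl) (s := [:: q]) erefl.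
rewrite big_seq1 fourier_op eqxx mulr1 => h.
have h2 := le_trans h (Ac _ pl).
have h3 : sqnorm (psi q) <= 1 ^+ 2 * tau.
  by apply: sqnorm_le => //; [exact: cmeas_psi|move=> t; rewrite nc_psi].
have : tau * nc (m q) ^+ 2 <= c ^+ 2 * tau.
  by apply: le_trans h2 _; rewrite ler_wpM2l ?sqr_ge0// (le_trans h3)// expr1n mul1r.
by rewrite mulrC ler_pM2r// ler_sqr ?nnegrE ?nc_ge0.
Qed.

(** On a partial Fourier sum the operator multiplies the coefficients by the
    symbol, by linearity. Partial sums converge uniformly to [synth a], hence in
    norm, and the operator is continuous. *)
Lemma wiener_multiplier f a : wiener f a -> wiener (A f) (fun q => m q * a q).
Proof.
move=> fa; have fs := wiener_synth fa; have [fl la _] := fa.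
have [[AL Aae Alin] _] := A_bounded.
have [c c0 Ac] := sqnorm_bounded A_bounded.
have [M mM] := symbol_bounded.
split; [exact: AL|exact: l1Z mM la|].
have sl := L2_synth la.
rewrite (fourier_ae _ _ (Aae _ _ fl sl fs)); [|exact: AL|exact: AL].
have [r [r0 rp ar]] := synth_tail la.
apply/funext => q; apply/eqP; rewrite -subr_eq0 -nc_eq0 eq_le nc_ge0 andbT.
apply: (le0_of_tail (C := c) (N0 := `|q|%N) r0) => N qN.
have pl := L2_synth_part a N.
have dl := L2B sl pl.
have -> : fourier (A (synth a)) q - m q * a q =
    fourier (A (fun t => synth a t - synth_part a N t)) q.
  have e1 := Alin 1 _ _ dl pl.
  have E : (fun t => 1 * (synth a t - synth_part a N t) + synth_part a N t) = synth a.
    by apply/funext => t; rewrite mul1r subrK.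
  rewrite E in e1; rewrite (fourier_ae _ _ e1); last 2 first.
  - exact: AL.
  - by apply: L2D; [apply: L2Z|]; exact: AL.
  rewrite fourierD//; [|by apply: L2Z; exact: AL|exact: AL].
  rewrite fourierZ//; last exact: AL.
  rewrite mul1r -addrA -[RHS]addr0; congr (_ + _).
  have := linear_map_sum (window N) a A_bounded.1 (L2_psi tau_gt0).
  move=> /(fourier_ae _ _) ->; last 2 first.
  - exact: AL.
  - by apply: L2_sum => // k; apply: L2Z; apply: AL; exact: L2_psi.
  rewrite fourier_sum; last 2 first.
  - by [].
  - by move=> k; apply: L2Z; apply: AL; exact: L2_psi.
  have qw : q \in window N by rewrite mem_window.
  rewrite (bigD1_seq _ qw (window_uniq N))/= fourierZ//; last first.
    by apply: AL; exact: L2_psi.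
  rewrite fourier_op eqxx mulr1 big1 ?addr0; first by rewrite mulrC subrr.
  move=> k kq; rewrite fourierZ//; last by apply: AL; exact: L2_psi.
  by rewrite fourier_op eq_sym (negPf kq) !mulr0.
have h1 := bessel tau_gt0 (AL _ dl) (s := [:: q]) erefl.
rewrite big_seq1 in h1.
have h2 : sqnorm (fun t => synth a t - synth_part a N t) <= r N ^+ 2 * tau.
  by apply: sqnorm_le => //; [exact: L2_cmeas dl|move=> t; rewrite nc_sub].
have := le_trans h1 (le_trans (Ac _ dl) (ler_wpM2l (sqr_ge0 c) h2)).
rewrite mulrC [leRHS]mulrA ler_pM2r// -exprMn ler_sqr ?nnegrE ?nc_ge0//.
exact: mulr_ge0.
Qed.

End Multiplier.

End AbsolutelyConvergent.

(** * Fourier coefficients of smooth functions *)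

Section ContinuouslyDifferentiable.
Variables (R : realType) (tau : R).
Hypothesis tau_gt0 : 0 < tau.

Local Notation fourier := (fourier tau).
Local Notation L2 := (L2 tau).

Lemma window_recr N :
  perm_eq (window N.+1) ((N.+1%:Z)%R :: (- N.+1%:Z)%R :: window N).
Proof.
apply: uniq_perm; first exact: window_uniq.
  by rewrite 2!cons_uniq window_uniq inE !mem_window andbT negb_or; lia.
by move=> q; rewrite [LHS]mem_window 2!in_cons mem_window; lia.
Qed.

(** The indices [N + 1] and [- N - 1] contribute the same amount, and the bound
    telescopes: [1 / (N + 1)^2] is at most [1 / N - 1 / (N + 1)]. *)
Lemma sum_invsq_window N :
  \sum_(q <- window N.+1) ((q%:~R : R) ^+ 2)^-1 <= 4 - 2 / N.+1%:R.
Proof.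
have invsqN (q : int) : (((- q)%:~R : R) ^+ 2)^-1 = ((q%:~R : R) ^+ 2)^-1.
  by rewrite intrN sqrrN.
elim: N => [|N IH]; rewrite (perm_big _ (window_recr _)) 2!big_cons invsqN/=.
  have -> : window 0 = [:: 0] by [].
  by rewrite big_seq1 expr0n/= invr0 addr0 !expr1n invr1; lra.
rewrite -!pmulrn addrA; apply: le_trans (lerD (lexx _) IH) _.
have n0 : 0 < (N.+1%:R : R) by rewrite ltr0n.
have n1 : 0 < (N.+2%:R : R) by rewrite ltr0n.
have E : (N.+2%:R : R) = N.+1%:R + 1 by rewrite natr1.
move: n0 n1; rewrite E; move: (N.+1%:R : R) => x x0 x1.
rewrite -subr_ge0.
have -> : 4 - 2 / (x + 1) - (((x + 1) ^+ 2)^-1 + ((x + 1) ^+ 2)^-1 + (4 - 2 / x)) =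
  2 / (x * (x + 1) ^+ 2).
  by field; rewrite !gt_eqF.
by rewrite divr_ge0// mulr_ge0 ?exprn_ge0// ltW.
Qed.

Lemma sum_invsq (s : seq int) : uniq s ->
  \sum_(q <- s) ((q%:~R : R) ^+ 2)^-1 <= 4.
Proof.
move=> us; have [N sN] := window_cover s.
apply: (@le_trans _ _ (\sum_(q <- window N.+1) ((q%:~R : R) ^+ 2)^-1)).
  apply: sum_subseq_le => //; first by move=> q; rewrite invr_ge0 sqr_ge0.
    exact: window_uniq.
  by move=> q /sN; rewrite !mem_window => /leqW.
by apply: le_trans (sum_invsq_window N) _; rewrite lerBlDr lerDl divr_ge0.
Qed.

(** A continuous function may be unbounded on the line, but its restriction to
    one period is bounded and equal to it on the circle. *)
Lemma continuous_L2 (u : R -> R) : continuous u -> L2 (to_complex u).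
Proof.
move=> cu; pose v := u \_ `[0, tau]%classic.
have [C vC] : exists C, forall t, `|v t| <= C.
  have /compact_bounded[M [_ Mu]] := continuous_compact
    (continuous_subspaceT cu) (@segment_compact R 0 tau).
  exists (`|M| + 1) => t; rewrite /v patchE; case: ifPn => [|_].
    rewrite inE => t0; apply: Mu; last by exists t.
    by rewrite (le_lt_trans (ler_norm _))// ltrDl.
  by rewrite normr0 addr_ge0.
have mu_ : measurable_fun setT u by exact: continuous_measurable_fun.
have vl : L2 (to_complex v).
  apply: (L2_bounded tau_gt0 (C := C)) => [|t]; last by rewrite nc_real.
  split; last exact: measurable_cst.
  apply/(measurable_restrictT _ _).1; first exact: measurable_itv.
  exact: measurable_funTS.
apply: ae_cmeas_L2 vl; last by split=> //; exact: measurable_cst.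
apply: circle_measure_ae; apply: aeW => t /andP[t0 tT] _.
by rewrite /to_complex /v patchE mem_setE in_itv/= t0 (ltW tT).
Qed.

(** Away from the index 0, the modulus of a coefficient is the product of the
    corresponding one of the derivative and of [1 / |k q|], hence at most the
    sum of the squares of these two factors. The former squares are summable by
    Bessel's inequality for the derivative. *)
Lemma C1_l1 (u : R -> R) : (forall t : R, derivable u t 1) ->
  continuous (derive1 u) -> u tau = u 0 -> l1 (fourier (to_complex u)).
Proof.
move=> du cu up.
have uc : continuous u.
  by move=> t; apply: differentiable_continuous; apply/derivable1_diffP.
have ul := continuous_L2 uc; have dul := continuous_L2 cu.
set P := fourier (to_complex u); set D := fourier (to_complex (derive1 u)).
have DP q : nc (D q) = `|omega tau q| * nc (P q).
  rewrite /D fourier_derive1// Normc.normcM; congr (_ * _).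
  by rewrite /= expr0n add0r sqrtr_sqr.
pose k : R := 2 * pi / tau.
have k0 : 0 < k by rewrite divr_gt0// mulr_gt0// pi_gt0.
have wE q : omega tau q = k * q%:~R by rewrite /omega /k; ring.
have bd q : nc (P q) <= (q == 0)%:R * nc (P 0) +
    (nc (D q) ^+ 2 + k ^- 2 * (q%:~R ^+ 2)^-1).
  case: eqP => [->|/eqP q0].
    by rewrite mul1r lerDl addr_ge0 ?sqr_ge0// mulr_ge0// invr_ge0 exprn_ge0// ltW.
  rewrite mul0r add0r DP wE -invfM -exprMn.
  have : 0 < `|k * q%:~R| by rewrite normr_gt0 mulf_eq0 negb_or gt_eqF//= intr_eq0.
  rewrite -[X in _ + X^-1]real_normK ?num_real//.
  have := nc_ge0 (P q); move: (nc (P q)) `|k * _| => x w x0 w0.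
  have : 0 <= (w * x - w^-1) ^+ 2 by exact: sqr_ge0.
  have -> : (w * x - w^-1) ^+ 2 = (w * x) ^+ 2 + (w ^+ 2)^-1 - 2 * x.
    by field; rewrite gt_eqF.
  by lra.
apply/l1P; exists (nc (P 0) + (sqnorm tau (to_complex (derive1 u)) / tau + k ^- 2 * 4)).
move=> s us; apply: le_trans (ler_sum _ (fun q _ => bd q)) _.
rewrite !big_split/= lerD//.
  have [s0|s0] := boolP (0 \in s).
    rewrite (bigD1_seq _ s0 us)/= mul1r big1 ?addr0// => q q0.
    by rewrite (negPf q0) mul0r.
  rewrite big1_seq ?nc_ge0// => q /= qs; case: eqP => [q0|]; last by rewrite mul0r.
  by rewrite -q0 qs in s0.
rewrite lerD//.
  by rewrite ler_pdivlMr// [leLHS]mulrC; exact: (bessel tau_gt0 dul us).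
by rewrite -mulr_sumr ler_wpM2l ?sum_invsq// invr_ge0 exprn_ge0// ltW.
Qed.

Lemma C2_wiener (p : R -> R) : C2_circle tau p ->
  wiener tau (to_complex p) (fourier (to_complex p)).
Proof.
move=> [pp dp ddp _].
have cp : continuous p.
  by move=> t; apply: differentiable_continuous; apply/derivable1_diffP.
have cdp : continuous (derive1 p).
  by move=> t; apply: differentiable_continuous; apply/derivable1_diffP.
split=> //; first exact: continuous_L2.
by apply: C1_l1 => //; rewrite -[tau]add0r pp.
Qed.

End ContinuouslyDifferentiable.

(** * Iterated sums as iterated convolutions *)

Section IteratedSums.
Variable R : realType.
Implicit Types (c : nat -> int -> R[i]) (F : seq int -> R[i]).

Fixpoint iconv c m : int -> R[i] :=
  if m is m'.+1 then conv (c 0%N) (iconv (fun j => c j.+1) m') else c 0%N.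

Lemma l1_iconv c m : (forall j, (j <= m)%N -> l1 (c j)) -> l1 (iconv c m).
Proof.
elim: m c => [|m IH] c lc /=; first exact: lc.
by apply: l1_conv; [exact: lc|apply: IH => j jm; exact: lc].
Qed.

Lemma ZsumZ x (a : int -> R[i]) : l1 a ->
  Zsum (fun k => x * a k) = x * Zsum a.
Proof.
move=> /Zsum_cvg a0; apply: Zsum_lim.
have -> : (fun N => nc (symsum (fun k => x * a k) N - x * Zsum a)) =
          (fun N => nc x * nc (symsum a N - Zsum a)).
  by apply/funext => N; rewrite -Normc.normcM mulrBr /symsum mulr_sumr.
by rewrite -(mulr0 (nc x)); apply: cvgM => //; exact: cvg_cst.
Qed.

(** Summability is needed to pull a factor out of [Zsum]: on sequences whose
    symmetric sums diverge, [Zsum] takes unspecified values. *)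
Lemma iterZsum_scale m x F : iterZsummable m F ->
  iterZsummable m (fun ks => x * F ks) /\
  iterZsum m (fun ks => x * F ks) = x * iterZsum m F.
Proof.
elim: m F => [|m IH] F //= [sF lF].
have E : (fun k => iterZsum m (fun ks => x * F (k :: ks))) =
         (fun k => x * iterZsum m (fun ks => F (k :: ks))).
  by apply/funext => k; have [] := IH _ (sF k).
rewrite E ZsumZ//; split=> //; split=> [k|]; first by have [] := IH _ (sF k).
exact: (l1Z (c := fun=> x) (C := nc x)).
Qed.

(** Only the factor of index 0 depends on the outermost difference [q - k], so
    it comes out of the inner sums, which form by induction the iterated
    convolution of the other sequences at [k]. *)
Lemma iterZsum_conv c m q : (forall j, (j <= m)%N -> l1 (c j)) ->
  let F ks := \prod_(0 <= j < m.+1) c j (kdiff (q :: ks) j) in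
  iterZsummable m F /\ iterZsum m F = iconv c m q.
Proof.
elim: m c q => [|m IH] c q lc /=.
  by rewrite big_nat1 /kdiff/= subr0.
pose c' j := c j.+1.
pose G k ks := \prod_(0 <= j < m.+1) c' j (kdiff (k :: ks) j).
have lc' j : (j <= m)%N -> l1 (c' j) by exact: (lc j.+1).
have E k : (fun ks => \prod_(0 <= j < m.+2) c j (kdiff [:: q, k & ks] j)) =
           (fun ks => c 0%N (q - k) * G k ks).
  by apply/funext => ks; rewrite big_nat_recl.
have S k := iterZsum_scale (c 0%N (q - k)) (IH c' k lc').1.
have EZ : (fun k => iterZsum m (fun ks => \prod_(0 <= j < m.+2) c j (kdiff [:: q, k & ks] j)))
        = (fun k => c 0%N (q - k) * iconv c' m k).
  by apply/funext => k; rewrite E (S k).2 (IH c' k lc').2.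
rewrite EZ; split=> //; split=> [k|]; first by rewrite E; exact: (S k).1.
by apply: l1_convterm; [exact: lc|exact: l1_iconv].
Qed.

Lemma wiener_prod tau (tau_gt0 : 0 < tau) (F : nat -> R -> R[i]) c m :
  (forall j, (j <= m)%N -> wiener tau (F j) (c j)) ->
  wiener tau (fun t => \prod_(0 <= j < m.+1) F j t) (iconv c m).
Proof.
elim: m F c => [|m IH] F c Fc /=.
  by under eq_fun do rewrite big_nat1; exact: Fc.
under eq_fun do rewrite big_nat_recl//.
apply: wiener_mul => //; first exact: Fc.
by apply: (IH (fun j => F j.+1)) => j jm; exact: Fc.
Qed.

End IteratedSums.

(** * The equation in terms of Fourier coefficients *)

Section OperatorEquation.
Variables (R : realType) (tau : R).
Hypothesis tau_gt0 : 0 < tau.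
Implicit Types f g h p r : R -> R[i].

Local Notation mu := (circle_measure tau).
Local Notation fourier := (fourier tau).
Local Notation psi := (psi tau).
Local Notation L2 := (L2 tau).
Local Notation ae_equal := (ae_equal tau).

Lemma ae_equal_sym f g : ae_equal f g -> ae_equal g f.
Proof. by apply: filterS => t /= + _ => ->. Qed.

Lemma ae_equal_refl f : ae_equal f f.
Proof. exact: aeW. Qed.

Lemma linear_mapD Z f g : linear_map tau Z -> L2 f -> L2 g ->
  ae_equal (Z (fun t => f t + g t)) (fun t => Z f t + Z g t).
Proof.
move=> [_ _ Zlin] fl gl; have := Zlin 1 _ _ fl gl.
have -> : (fun t => 1 * f t + g t) = (fun t => f t + g t).
  by apply/funext => t; rewrite mul1r.
by apply: filterS => t /= + _ => ->//; rewrite mul1r.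
Qed.

Lemma op_hat_fourier (A : operator R) p r : linear_operator tau A ->
  L2 p -> L2 r -> op_hat tau A (fourier p) (fourier r) <-> A p r.
Proof.
move=> [AL Aae _ _ _] pl rl; split=> [[f [g [Afg fp gr]]]|Apr]; last by exists p, r.
have [fl gl] := AL _ _ Afg.
by apply: (Aae f g) => //; apply: fourier_unique.
Qed.

(** Applying [J = Z^-1 (1 - Z L)] to [p] means solving [Z g = p - Z l] with [l]
    the value of [L] at [p]; that [g = r] is a solution is the equation
    [p = Z (l + r)]. In the converse direction the functions are only known
    through their coefficients, and uniqueness recovers them. *)
Lemma Jop_equation (Z : (R -> R[i]) -> R -> R[i]) (L : operator R) p r :
  linear_map tau Z -> linear_operator tau L -> L2 p -> L2 r ->
  (exists2 l, L p l & ae_equal p (Z (fun t => l t + r t))) <->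
  op_hat tau (Jop tau Z L) (fourier p) (fourier r).
Proof.
move=> Zlin [LL Lae _ _ _] pl rl; have [ZL Zae _] := Zlin.
have FF := ae_filter_ringOfSetsType mu.
split=> [[l Lpl pZ]|[f [g [Jfg fp gr]]]].
  have [_ ll] := LL _ _ Lpl.
  exists p, r; split=> //; exists (Z r); last first.
    by split=> //; [exact: ZL|exact: ae_equal_refl].
  exists p, (Z l); split.
  - by split=> //; exact: ae_equal_refl.
  - by exists l => //; split=> //; [exact: ZL|exact: ae_equal_refl].
  - exact: ZL.
  - have := linear_mapD Zlin ll rl; apply: filterS2 pZ => t /= e1 e2 _.
    by rewrite e1// e2// addrC addKr.
have [y [g1 [g2 [[fl g1l fg1] [l Lfl [ll g2l g2Z]] yl yE]]] [gl _ yZ]] := Jfg.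
have fpe : ae_equal f p by exact: fourier_unique.
have gre : ae_equal g r by exact: fourier_unique.
exists l; first by apply: (Lae f l) => //; exact: ae_equal_refl.
have Zgr := Zae _ _ gl rl gre.
have Zlr := linear_mapD Zlin ll rl.
have E1 : ae_equal (Z r) (fun t => g1 t - g2 t).
  by move: Zgr yZ yE; apply: filterS3 => t /= e1 e2 e3 _; rewrite -e1// -e2// e3.
have E2 : ae_equal g1 p.
  by move: fg1 fpe; apply: filterS2 => t /= e1 e2 _; rewrite e1// e2.
have E3 : ae_equal p (fun t => Z l t + Z r t).
  move: E1 E2 g2Z; apply: filterS3 => t /= e1 e2 e3 _.
  by rewrite e1// e2// e3// addrC subrK.
by move: E3 Zlr; apply: filterS2 => t /= e1 e2 _; rewrite e1// e2.
Qed.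

Lemma symbol_eigenvector (A : operator R) q : psi_eigenvector tau A q ->
  A (psi q) (fun t => symbol tau A q * psi q t).
Proof.
move=> [l Al].
exact: (@xgetPex _ 0 [set l | A (psi q) (fun t => l * psi q t)] (ex_intro _ l Al)).
Qed.

Lemma L2_fourier_proj q f : L2 (fourier_proj tau q f).
Proof. by apply: L2Z; exact: L2_psi. Qed.

Lemma L2_Qcompl e f : L2 f -> L2 (Qcompl tau e f).
Proof.
by move=> fl; apply: L2B => //; apply: L2D; exact: L2_fourier_proj.
Qed.

Lemma fourier_Qcompl e f q : e != 0 -> L2 f ->
  fourier (Qcompl tau e f) q =
  if (q == e) || (q == - e) then 0 else fourier f q.
Proof.
move=> e0 fl; have pl k := L2_fourier_proj k f.
rewrite fourierB//; last exact: L2D.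
rewrite fourierD// /fourier_proj !fourierZ//; try exact: L2_psi.
rewrite !fourier_psi//; have eNe : (e == - e) = false.
  by apply/negbTE; move: e0; lia.
case: eqP => [->|_] /=; first by rewrite eNe mulr1 mulr0 addr0 subrr.
case: eqP => [->|_] /=; first by rewrite mulr1 mulr0 add0r subrr.
by rewrite !mulr0 addr0 subr0.
Qed.

(** That the coefficients match does not yet put [p] in the domain of [J]. The
    bounded inverse provides an element [v] of the domain such that [J v] has
    the coefficients of [r] except at the indices [e] and [- e], where they
    vanish. The eigenvalues at the other indices being nonzero, [v] has there
    the coefficients of [p]. The two modes that are missing are eigenvectors,
    so adding them to [v] stays in the domain. *)
Lemma multiplier_equation (J : operator R) e p r :
  linear_operator tau J -> fourier_diagonalizable tau J -> e != 0 ->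
  bounded_inverse_on_Q tau e J -> L2 p -> L2 r ->
  op_hat tau J (fourier p) (fourier r) <->
  (forall q, symbol tau J q * fourier p q = fourier r q).
Proof.
move=> Jlin [Jeig Jdiag] e0 [B [_ Binv1 Binv2]] pl rl.
split=> [/(op_hat_fourier Jlin pl rl) Jpr q|pr]; first by rewrite (Jdiag _ _ Jpr).
apply/(op_hat_fourier Jlin pl rl).
have [JL Jae _ J0 Jlinear] := Jlin.
set s := symbol tau J in pr *.
have Js q : J (psi q) (fun t => s q * psi q t) by apply: symbol_eigenvector.
have L0 : L2 (fun=> 0) by exact: L2_cst.
have f0 q : fourier (fun=> 0) q = 0.
  have -> : (fun=> 0 : R[i]) = (fun t : R => 0 * psi 0 t).
    by apply/funext => t; rewrite mul0r.
  by rewrite fourierZ ?mul0r//; exact: L2_psi.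
have Qfix f : L2 f -> fourier f e = 0 -> fourier f (- e) = 0 ->
    ae_equal (Qcompl tau e f) f.
  move=> fl fe fNe; apply: fourier_unique => //; first exact: L2_Qcompl.
  apply/funext => q; rewrite fourier_Qcompl//.
  by case: eqP => [->|_]//=; case: eqP => [->|].
(* Otherwise [psi q] and 0, both in the range of Q, would have the same image,
   and the inverse would send it to both. *)
have s_neq0 q : q != e -> q != - e -> s q != 0.
  move=> qe qNe; apply/eqP => sq0.
  have pq := L2_psi tau_gt0 q.
  have Qpsi : ae_equal (Qcompl tau e (psi q)) (psi q).
    by apply: Qfix => //; rewrite fourier_psi// eq_sym ?(negPf qe) ?(negPf qNe).
  have Q0 : ae_equal (Qcompl tau e (fun=> 0)) (fun=> 0) by exact: Qfix.
  have J0q : J (psi q) (fun=> 0).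
    have -> : (fun=> 0 : R[i]) = (fun t => s q * psi q t).
      by apply/funext => t; rewrite sq0 mul0r.
    exact: Js.
  have B1 : ae_equal (B (fun=> 0)) (psi q).
    apply: Binv1; first by split.
    exists (fun=> 0); last by split=> //; exact: ae_equal_sym.
    by exists (psi q) => //; split=> //; exact: ae_equal_sym.
  have B2 : ae_equal (B (fun=> 0)) (fun=> 0).
    apply: Binv1; first by split.
    exists (fun=> 0); last by split=> //; exact: ae_equal_sym.
    by exists (fun=> 0) => //; split=> //; exact: ae_equal_sym.
  have FF := ae_filter_ringOfSetsType mu.
  have /(fourier_ae pq L0) : ae_equal (psi q) (fun=> 0).
    by move: B1 B2; apply: filterS2 => t /= e1 e2 _; rewrite -e1// e2.
  move=> /(congr1 (fun u => u q)); rewrite f0 fourier_psi// eqxx => /eqP.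
  by rewrite oner_eq0.
pose g := Qcompl tau e r.
have gl : L2 g by exact: L2_Qcompl.
have gq q : fourier g q = if (q == e) || (q == - e) then 0 else fourier r q.
  exact: fourier_Qcompl.
have g_inQ : L2 g /\ ae_equal (Qcompl tau e g) g.
  split=> //; apply: Qfix => //; first by rewrite gq eqxx.
  by rewrite gq eqxx orbT.
have [_ [w [v [Bl vl vE] Jvw] [wl _ gE]]] := Binv2 g g_inQ.
have vq q : fourier v q = if (q == e) || (q == - e) then 0 else fourier p q.
  have -> : fourier v q = fourier (Qcompl tau e (B g)) q.
    by rewrite (fourier_ae vl (L2_Qcompl e Bl) vE).
  rewrite fourier_Qcompl//; case: ifPn => // qe.
  have := gq q; rewrite (negPf qe).
  rewrite (fourier_ae gl (L2_Qcompl e wl) gE) fourier_Qcompl// (negPf qe).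
  rewrite (Jdiag _ _ Jvw) -/s -pr.
  rewrite (fourier_ae vl (L2_Qcompl e Bl) vE) fourier_Qcompl// (negPf qe).
  by move: qe; rewrite negb_or => /andP[qe qNe]; apply: mulfI; exact: s_neq0.
pose P := fourier p.
have eNe : (- e == e) = false by apply/negbTE; move: e0; lia.
have lp k : L2 (fun t => s k * psi k t) by apply: L2Z; exact: L2_psi.
have J1 := Jlinear (P e) _ _ _ _ (Js e) (Jlinear (P (- e)) _ _ _ _ (Js (- e)) Jvw).
have [l1 l2] := JL _ _ J1.
apply: (Jae _ _ _ _ J1) => //; apply: fourier_unique => //; apply/funext => q.
  rewrite fourierD//; [|by apply: L2Z; exact: L2_psi|]; last first.
    by apply: L2D => //; apply: L2Z; exact: L2_psi.
  rewrite fourierD//; last by apply: L2Z; exact: L2_psi.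
  rewrite !fourierZ//; try exact: L2_psi.
  rewrite !fourier_psi// vq.
  case: eqP => [->|_] /=; first by rewrite eq_sym eNe mulr1 mulr0 !addr0.
  by case: eqP => [->|_] /=; rewrite ?mulr1 mulr0 ?addr0 ?add0r// mulr0 add0r.
rewrite fourierD//; [|by apply: L2Z|]; last by apply: L2D => //; exact: L2Z.
rewrite fourierD//; last exact: L2Z.
rewrite !fourierZ//; try exact: L2_psi.
rewrite !fourier_psi// (Jdiag _ _ Jvw) -/s vq -pr.
case: eqP => [->|_] /=.
  by rewrite eq_sym eNe !mulr1 !mulr0 !addr0 mulrC.
by case: eqP => [->|_] /=; rewrite ?mulr1 !mulr0 ?addr0 ?add0r// mulrC.
Qed.

End OperatorEquation.

(** * The nonlinear terms and their sum *)

Section Terms.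
Variables (R : realType) (tau : R).
Hypothesis tau_gt0 : 0 < tau.
Local Notation L2 := (L2 tau).
Local Notation fourier := (fourier tau).

(** Each factor of [Rn] is in the Wiener algebra, with the symbol times the
    coefficients of [p] as its coefficients; distributing the product over the
    symbols and the coefficients turns the summand of [Sseq] into the summand
    of the iterated convolution. *)
Lemma Rn_wiener Zn (gamma : R) (p : R -> R) n :
  let P := fourier (to_complex p) in
  let Sn := Sseq (gn tau Zn gamma n) n P in
  (0 < n)%N ->
  (forall m, (1 <= m <= n)%N -> bounded_linear_map tau (Zn gamma n m) /\
     forall q, psi_eigenvector tau (op_graph tau (Zn gamma n m)) q) ->
  wiener tau (to_complex p) P ->
  Sseq_defined (gn tau Zn gamma n) n P /\ wiener tau (Rn Zn gamma p n) Sn.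
Proof.
move=> P Sn; case: n @Sn => // m Sn _ HZ Hp.
pose c j q := symbol tau (op_graph tau (Zn gamma m.+1 j.+1)) q * P q.
have Hc j : (j <= m)%N -> wiener tau (Zn gamma m.+1 j.+1 (to_complex p)) (c j).
  by move=> jm; have [Zb Ze] := HZ j.+1 jm; exact: wiener_multiplier.
have SE q : (fun ks => Sterm (gn tau Zn gamma m.+1) m.+1 P (q :: ks)) =
            (fun ks => \prod_(0 <= j < m.+1) c j (kdiff (q :: ks) j)).
  by apply/funext => ks; rewrite /Sterm /gn -big_split.
have lc j : (j <= m)%N -> l1 (c j) by move=> /Hc[].
have SnE : Sn = iconv c m.
  by apply/funext => q; rewrite /Sn /Sseq SE; exact: (iterZsum_conv q lc).2.
split=> [q|]; first by rewrite SE; exact: (iterZsum_conv q lc).1.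
rewrite SnE; have -> : Rn Zn gamma p m.+1 =
    (fun t => \prod_(0 <= j < m.+1) Zn gamma m.+1 j.+1 (to_complex p) t).
  by apply/funext => t; rewrite /Rn big_add1.
exact: wiener_prod.
Qed.

(** Bessel's inequality for the differences. *)
Lemma fourier_l2_converges (f_ : nat -> R -> R[i]) f :
  (forall M, L2 (f_ M)) -> L2 f -> L2_converges tau f_ f ->
  l2_converges (fun M => fourier (f_ M)) (fourier f).
Proof.
move=> fM fl /(L2_converges_sqnorm fM fl) cv.
have cv2 : ((sqnorm tau (fun t => f_ M t - f t) / tau)%:E @[M --> \oo] --> 0%E)%E.
  apply/fine_cvgP; split; first exact: nearW.
  by rewrite -(mul0r tau^-1); apply: cvgM => //; exact: cvg_cst.
apply: (squeeze_cvge _ (cvg_cst 0%E) cv2); apply: nearW => M.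
apply/andP; split; first by apply: esum_ge0 => q _; rewrite lee_fin sqr_ge0.
apply/esum_leP => [q|s us]; first exact: sqr_ge0.
under eq_bigr do rewrite -fourierB//.
by rewrite ler_pdivlMr// mulrC bessel//; exact: L2B.
Qed.

End Terms.

Theorem lemma3p1 (R : realType) (tau eps : R)
  (Omega1 Omega : set R) (gamma0 : R)
  (Z : (R -> R[i]) -> R -> R[i]) (L : R -> operator R)
  (Zn : R -> nat -> nat -> (R -> R[i]) -> R -> R[i])
  (Rbar : R -> (R -> R) -> R -> R[i])
  (e : int) (beta_p beta_m : R -> R[i])
  (tau_gt0 : 0 < tau) (eps_gt0 : 0 < eps)
  (Omega1_nonempty : Omega1 !=set0) (Omega1_open : open Omega1)
  (Omega1_sc : simply_connected Omega1)
  (OmegaE : Omega = closure Omega1) (gamma0_Omega : Omega gamma0)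
  (Z_linear : linear_map tau Z)
  (L_linear : forall gamma, Omega gamma -> linear_operator tau (L gamma))
  (e_neq0 : e != 0)
  (H2 : hypothesis_H2 tau Omega gamma0 (fun gamma => Jop tau Z (L gamma))
          e beta_p beta_m)
  (H3 : hypothesis_H3 tau eps Omega Zn Rbar)
  (p0 : R -> R) (p0_Lambda : Lambda tau eps p0) :
  let P := fourier tau (to_complex p0) in
  forall gamma : R, Omega gamma ->
  let Sn (n : nat) := Sseq (gn tau Zn gamma n) n P in
  let J := Jop tau Z (L gamma) in
  (forall n : nat, (2 <= n)%N ->
     [/\ L2 tau (Rn Zn gamma p0 n),
         Sseq_defined (gn tau Zn gamma n) n P,
         fourier tau (Rn Zn gamma p0 n) = Sn n
       & l1 (Sn n)]) /\
  (exists Ssum : int -> R[i],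
     [/\ l2 Ssum,
         l2_converges (fun M q => \sum_(2 <= n < M.+1) Sn n q) Ssum,
         fourier tau (Rbar gamma p0) = Ssum,
         solves tau Z L Rbar gamma p0 <-> op_hat tau J P Ssum
       & op_hat tau J P Ssum <-> (forall q, symbol tau J q * P q = Ssum q)]).
Proof.
move=> P gamma Og Sn J.
have [/(_ gamma Og)[J_closed J_diag] _ _ /(_ gamma Og) J_inv] := H2.
have [/(_ gamma Og) HZ /(_ gamma p0 Og p0_Lambda)[Rl Rcv]] := H3.
have pW := C2_wiener tau_gt0 p0_Lambda.1.
have [pl _ _] := pW.
have HR n : (2 <= n)%N -> Sseq_defined (gn tau Zn gamma n) n P /\
                          wiener tau (Rn Zn gamma p0 n) (Sn n).
  move=> n2; apply: Rn_wiener pW => //; first exact: ltnW.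
  by move=> m; exact: HZ.
split=> [n n2|]; first by have [? []] := HR n n2.
exists (fourier tau (Rbar gamma p0)); split=> //.
- exact: fourier_l2.
(* The functions R_0 and R_1 need not be in L^2; they are replaced by 0. *)
- pose F n t := if (2 <= n)%N then Rn Zn gamma p0 n t else 0.
  have Fl n : L2 tau (F n).
    rewrite /F; case: (leqP 2 n) => n2; last exact: L2_cst.
    by have [_ []] := HR n n2.
  have FR M : (fun t => \sum_(2 <= n < M.+1) Rn Zn gamma p0 n t) =
              (fun t => \sum_(2 <= n < M.+1) F n t).
    apply/funext => t; apply: eq_big_nat => n /andP[n2 _].
    by rewrite /F n2.
  have SlE : (fun M q => \sum_(2 <= n < M.+1) Sn n q) =
      (fun M => fourier tau (fun t => \sum_(2 <= n < M.+1) Rn Zn gamma p0 n t)).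
    apply/funext => M; apply/funext => q; rewrite FR fourier_sum//.
    apply: eq_big_nat => n /andP[n2 _].
    have [_ [_ _ <-]] := HR n n2; congr (fourier tau _ q).
    by apply/funext => t; rewrite /F n2.
  rewrite SlE; apply: fourier_l2_converges => // M.
  by rewrite FR; exact: L2_sum.
- exact: Jop_equation (L_linear gamma Og) pl Rl.
- exact: multiplier_equation J_closed.1 J_diag e_neq0 J_inv pl Rl.
Qed.
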